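(* For every $\varepsilon>0$ there exists a strong-probe local computation algorithm that, on $d$-regular graphs of girth $g$ with $d\ge \frac{1}{\varepsilon}$ and $g\ge\frac{1}{\varepsilon^3}$, finds a $(1-\varepsilon)$-approximate maximum matching in expectation, using $O(1/\varepsilon^7)$ probes per query.
   Context: The girth of a graph is the length of its shortest cycle. A strong probe specifies a vertex $v$ of the input graph and returns the list of all neighbors of $v$. The local computation algorithm may use randomness; it is queried on an edge and answers ''yes''/''no'', and all answers must be consistent with a single matching $M$. A $(1-\varepsilon)$-approximate maximum matching in expectation means the expected size of $M$ (over the algorithm's randomness) is at least $(1-\varepsilon)$ times the maximum matching size. *)

(* Defs.v *)
From mathcomp Require Import all_boot all_order all_algebra.
From mathcomp Require Import classical_sets reals ereal.

Set Implicit Arguments.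
Unset Strict Implicit.
Unset Printing Implicit Defensive.

Import Order.TTheory GRing.Theory Num.Theory.
Local Open Scope ring_scope.

Record graph (n : nat) := Graph {
  adj :> rel 'I_n;
  adj_sym : symmetric adj;
  adj_irrefl : irreflexive adj
}.

Definition neighbors n (G : graph n) (v : 'I_n) : {set 'I_n} :=
  [set w | adj G v w]%SET.

Definition regular n (G : graph n) (d : nat) : Prop :=
  forall v : 'I_n, #|neighbors G v| = d.

Definition edges n (G : graph n) : {set {set 'I_n}} :=
  [set e : {set 'I_n} |
    [exists u, exists v, adj G u v && (e == [set u; v])]]%SET.

Definition is_cycle n (G : graph n) (c : seq 'I_n) : Prop :=
  (2 < size c)%N /\ ucycle (adj G) c.

(* The girth of an acyclic graph is +oo. *)
Definition girth (R : realType) n (G : graph n) : \bar R :=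
  ereal_inf [set ((size c)%:R)%:E | c in [set c | is_cycle G c]]%classic.

Definition is_matching n (G : graph n) (M : {set {set 'I_n}}) : bool :=
  (M \subset edges G) && finset.trivIset M.

Definition max_matching_size n (G : graph n) : nat :=
  (\max_(M : {set {set 'I_n}} | is_matching G M) #|M|)%N.

(* An adaptive probing strategy: [Probe v k] makes a strong probe at [v] and
   continues with [k S], where [S] is the returned neighborhood of [v]. *)
Inductive probing (n : nat) : Type :=
| Answer of bool
| Probe of 'I_n & ({set 'I_n} -> probing n).

Fixpoint answer n (G : graph n) (t : probing n) : bool :=
  match t with
  | Answer b => b
  | Probe v k => answer G (k (neighbors G v))
  end.

Fixpoint num_probes n (G : graph n) (t : probing n) : nat :=
  match t with
  | Answer _ => 0%N
  | Probe v k => (num_probes G (k (neighbors G v))).+1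
  end.

(* The algorithm knows the number n of vertices, the random seed (drawn once
   and shared by all queries) and the queried edge; it learns about the graph
   only through probes. Finitely many seeds for each n lose no generality:
   probes and replies on n vertices range over finite sets, so only finitely
   many bounded-depth strategies exist. *)
Record lca (R : realType) := Lca {
  seed : nat -> finType;
  seed_prob : forall n, seed n -> R;
  seed_prob_ge0 : forall n (r : seed n), 0 <= seed_prob r;
  seed_prob_sum1 : forall n, \sum_(r : seed n) seed_prob r = 1;
  strategy : forall n, seed n -> {set 'I_n} -> probing n
}.

Definition lca_edges (R : realType) (A : lca R) n (G : graph n) (r : seed A n) :
    {set {set 'I_n}} :=
  [set e in edges G | answer G (strategy r e)]%SET.

Definition lca_expected_size (R : realType) (A : lca R) n (G : graph n) : R :=
  \sum_(r : seed A n) seed_prob r * #|lca_edges G r|%:R.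

(* Main.v *)
(** Give every edge an independent uniform rank and run the greedy matching that
    inserts the edges by increasing rank, stopping at time about [1/eps], where time
    is the rank rescaled so that every vertex sees one new edge per unit of time.
    On a tree, the probability [q(s)] that an endpoint is still free at time [s]
    satisfies [q' = - q^2], so [q(s) = 1/(1+s)] when [d] is large, and a fraction of
    at most about [eps] of the vertices stays unmatched.

    The status of an edge is decided by a recursive search of depth [k] which inspects
    the lower edges at a vertex by increasing rank and stops as soon as the vertex is
    known to be matched; it gives up when the depth is exhausted.  Edges that are
    certified to be in the greedy matching form a matching whatever the graph is.
    If all cycles are longer than [2k], the branches of the search use disjoint sets
    of ranks, hence are independent.  Then the expected number of probes [V] of a
    search satisfies [V' = q V], so it is polynomial in [1/eps], and the probability
    of giving up at depth [k] is at most [(ln(1+s))^k / k!].  Cutting the search off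
    after [O(1/eps^7)] probes loses a negligible part of the matching by Markov's
    inequality.  For [eps >= 1/2] the local minima already suffice. *)

Require Import Defs.
From mathcomp Require Import all_boot all_order all_algebra perm.
From mathcomp Require Import classical_sets reals ereal.
From mathcomp Require Import sequences exp.
From mathcomp Require Import zify ring lra.

Set Implicit Arguments.
Unset Strict Implicit.
Unset Printing Implicit Defensive.

Import Order.TTheory GRing.Theory Num.Theory.
Local Open Scope ring_scope.

(** * The recursion for the status probabilities *)

(** Seeds form a finite set, so ranks live in ['I_N] and may tie; the differential equations become
    difference recursions in the rank, and no limit is taken. Every estimate is an inequality on the
    grid with an error of the form [d^c / N], and [N] is chosen from [n] and [eps] alone, large
    enough for all degrees [d <= n]. The degree is unbounded, so depth, cut-off and losses must be
    controlled independently of [d]. This goes through the cumulated hazard [H]: if [y' = - y^b]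
    with [b = d - 1], then [exp H = y^-b], which is at most [(1 + s)(1 + (b-1)s)] for [s = t/d],
    hence linear in [t]. Stopping at [t = m + 1], where [m] is the integer part of [1/eps], leaves
    about [1/(m+2)] of the vertices unmatched, while [eps > 1/(m+1)]. This gap of order [1/m^2] has
    to pay for undecided searches, ties and truncation; truncation after [L] probes costs order
    [exp(2H) t / L], that is [m^3 / L]. *)

Lemma subrX_ge (R : realDomainType) (b : nat) (x y : R) : 0 <= x -> x <= y ->
  b%:R * x ^+ b.-1 * (y - x) <= y ^+ b - x ^+ b.
Proof.
move=> x0 xy; elim: b => [|b IH]; first by rewrite !expr0 !mul0r subrr.
have -> : y ^+ b.+1 - x ^+ b.+1 = y * (y ^+ b - x ^+ b) + x ^+ b * (y - x).
  by rewrite !exprS; ring.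
have h : x * (b%:R * x ^+ b.-1 * (y - x)) <= y * (y ^+ b - x ^+ b).
  apply: ler_pM => //; rewrite !mulr_ge0 ?exprn_ge0 ?ler0n ?subr_ge0 //.
apply: le_trans (lerD h (lexx _)).
case: b {IH h} => [|b] /=; first by rewrite !expr0; lra.
by rewrite exprS [b.+2%:R]mulrSr le_eqVlt; apply/orP; left; apply/eqP; ring.
Qed.

(** Together with [subrX_ge], the mean value bounds for [x ^+ b] that replace derivatives of powers
    in the difference recursions. *)
Lemma subrX_le (R : realDomainType) (b : nat) (x y : R) : 0 <= x -> x <= y ->
  y ^+ b - x ^+ b <= b%:R * y ^+ b.-1 * (y - x).
Proof.
move=> x0 xy; have y0 := le_trans x0 xy.
elim: b => [|b IH]; first by rewrite !expr0 !mul0r subrr.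
have -> : y ^+ b.+1 - x ^+ b.+1 = y * (y ^+ b - x ^+ b) + x ^+ b * (y - x).
  by rewrite !exprS; ring.
have h : y * (y ^+ b - x ^+ b) <= y * (b%:R * y ^+ b.-1 * (y - x)).
  exact: ler_wpM2l.
have h2 : x ^+ b * (y - x) <= y ^+ b * (y - x).
  by rewrite ler_wpM2r ?subr_ge0 // lerXn2r ?nnegrE.
apply: le_trans (lerD h h2) _.
case: b {IH h h2} => [|b] /=; first by rewrite !expr0; lra.
by rewrite exprS [b.+2%:R]mulrSr le_eqVlt; apply/orP; left; apply/eqP; ring.
Qed.

Section Law.
Variables (R : realType) (N b : nat).
Hypothesis N0 : (0 < N)%N.
Local Notation p := (N%:R^-1 : R).

(* [pfree k i] and [pdead k i] are the probabilities that the search of depth [k] from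
   the child end of an edge of rank [i] certifies that this end is free, respectively
   matched, just before the edge arrives; [b] is the number of children and [p] the
   probability of a rank.  [surv k i] is the probability that a given child edge has
   rank at least [i] or leads to a certified matched vertex. *)
Fixpoint law k : (nat -> R) * (nat -> R) :=
  if k is k'.+1 then
    let Z i := 1 - p * \sum_(l < i) (1 - (law k').2 l) in
    (fun i => Z i.+1 ^+ b,
     fun i => b%:R * p * \sum_(j < i) (law k').1 j * (Z j - p) ^+ b.-1)
  else (fun=> 0, fun=> 0).

Definition pfree k i := (law k).1 i.
Definition pdead k i := (law k).2 i.
Definition surv k i : R := 1 - p * \sum_(l < i) (1 - pdead k l).

Lemma pfreeS k i : pfree k.+1 i = surv k i.+1 ^+ b. Proof. by []. Qed.
(** In the term for rank [j], a sibling of the matching child must have rank above [j], or below [j]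
    and a certified matched end; the [- p] removes a tie at [j], which leaves the vertex
    undecided. *)
Lemma pdeadS k i :
  pdead k.+1 i = b%:R * p * \sum_(j < i) pfree k j * (surv k j - p) ^+ b.-1.
Proof. by []. Qed.
Lemma pdeadSS k i : pdead k.+1 i.+1 =
  pdead k.+1 i + b%:R * p * (pfree k i * (surv k i - p) ^+ b.-1).
Proof. by rewrite !pdeadS big_ord_recr /= mulrDr. Qed.
Lemma pdeadS0 k : pdead k.+1 0 = 0.
Proof. by rewrite pdeadS big_ord0 mulr0. Qed.
Lemma surv0 k : surv k 0 = 1.
Proof. by rewrite /surv big_ord0 mulr0 subr0. Qed.
Lemma survS k i : surv k i.+1 = surv k i - p * (1 - pdead k i).
Proof. by rewrite /surv big_ord_recr /=; ring. Qed.

Lemma p_gt0 : 0 < p. Proof. by rewrite invr_gt0 ltr0n. Qed.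
Lemma p_ge0 : 0 <= p. Proof. exact: ltW p_gt0. Qed.
Lemma rank_count_mulV : N%:R * p = 1.
Proof. by rewrite mulfV // pnatr_eq0 -lt0n. Qed.
Lemma mulp_le1 i : (i <= N)%N -> i%:R * p <= 1.
Proof. by move=> iN; rewrite -[leRHS]rank_count_mulV ler_wpM2r ?p_ge0 // ler_nat. Qed.

(** Derived from the recursion alone, as the probabilistic reading needs large girth. Each step
    lowers [surv ^+ b] by at least what [pdead] gains, so [pdead <= 1 - surv ^+ b]. *)
Lemma law_bounds k i : (i < N)%N ->
  [/\ 0 <= pfree k i, 0 <= pdead k i & pfree k i + pdead k i <= 1].
Proof.
elim: k i => [|k IH] i iN; first by rewrite /pfree /pdead /= addr0 lexx ler01.
have sl j : (j <= N)%N -> 1 - j%:R * p <= surv k j.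
  elim: j => [|j IHj] jN; first by rewrite surv0; lra.
  have [f0 d0 fd] := IH j jN; have := IHj (ltnW jN); rewrite survS -natr1.
  have := mulr_ge0 p_ge0 d0; lra.
have sp j : (j < N)%N -> 0 <= surv k j - p.
  move=> jN; have := sl j (ltnW jN); have := mulp_le1 jN; rewrite -natr1; lra.
have s1 j : (j < N)%N -> surv k j.+1 <= surv k j.
  move=> jN; have [f0 d0 fd] := IH j jN; rewrite survS gerBl mulr_ge0 ?p_ge0 //; lra.
have s2 j : (j < N)%N -> surv k j - p <= surv k j.+1.
  move=> jN; have [f0 d0 fd] := IH j jN; rewrite survS.
  have := mulr_ge0 p_ge0 d0; lra.
have s0 j : (j <= N)%N -> 0 <= surv k j.
  by move=> jN; apply: le_trans (sl j jN); rewrite subr_ge0 mulp_le1.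
split.
- by rewrite pfreeS exprn_ge0 // s0.
- rewrite pdeadS !mulr_ge0 ?ler0n ?p_ge0 // sumr_ge0 // => j _.
  have jN := ltn_trans (ltn_ord j) iN.
  by have [f0 _ _] := IH j jN; rewrite mulr_ge0 ?exprn_ge0 ?sp.
have key j : (j <= i)%N -> pdead k.+1 j <= 1 - surv k j ^+ b.
  elim: j => [|j IHj] ji; first by rewrite pdeadS0 surv0 expr1n subrr.
  have jN := ltn_trans ji iN.
  have [f0 d0 fd] := IH j jN; have {}IHj := IHj (ltnW ji).
  have := subrX_ge b (s0 j.+1 jN) (s1 j jN).
  rewrite pdeadSS => h.
  suff : b%:R * p * (pfree k j * (surv k j - p) ^+ b.-1) <=
         b%:R * surv k j.+1 ^+ b.-1 * (surv k j - surv k j.+1) by lra.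
  have -> : b%:R * p * (pfree k j * (surv k j - p) ^+ b.-1) =
            b%:R * (surv k j - p) ^+ b.-1 * (p * pfree k j) by ring.
  apply: ler_pM.
  - by rewrite mulr_ge0 ?exprn_ge0 ?sp ?ler0n.
  - by rewrite mulr_ge0 ?p_ge0.
  - rewrite ler_wpM2l ?ler0n // lerXn2r ?nnegrE ?sp ?s0 //; exact: s2.
  - rewrite survS opprB addrC subrK ler_wpM2l ?p_ge0 //; lra.
have := key i (leqnn _); rewrite pfreeS.
suff : surv k i.+1 ^+ b <= surv k i ^+ b by lra.
by rewrite lerXn2r ?nnegrE ?s0 ?s1 // ltnW.
Qed.

Lemma surv_bounds k i : (i < N)%N ->
  [/\ 0 <= surv k i - p, surv k i - p <= surv k i.+1 & surv k i.+1 <= surv k i].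
Proof.
move=> iN.
have sl j : (j <= N)%N -> 1 - j%:R * p <= surv k j.
  elim: j => [|j IHj] jN; first by rewrite surv0; lra.
  have [f0 d0 fd] := law_bounds k jN; have := IHj (ltnW jN); rewrite survS -natr1.
  have := mulr_ge0 p_ge0 d0; lra.
have [f0 d0 fd] := law_bounds k iN; split.
- have := sl i (ltnW iN); have := mulp_le1 iN; rewrite -natr1; lra.
- by rewrite survS; have := mulr_ge0 p_ge0 d0; lra.
- rewrite survS gerBl mulr_ge0 ?p_ge0 //; lra.
Qed.

Lemma surv_ge0 k i : (i <= N)%N -> 0 <= surv k i.
Proof.
case: i => [|i] iN; first by rewrite surv0 ler01.
by have [h1 h2 _] := surv_bounds k iN; apply: le_trans h2.
Qed.

Lemma law_mono k i : (i < N)%N ->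
  pfree k i <= pfree k.+1 i /\ pdead k i <= pdead k.+1 i.
Proof.
elim: k i => [|k IH] i iN.
  by have [h1 h2 _] := law_bounds 1 iN.
have sm j : (j <= N)%N -> surv k j <= surv k.+1 j.
  elim: j => [|j IHj] jN; first by rewrite !surv0.
  rewrite !survS; have := IHj (ltnW jN); have [_ h] := IH j jN.
  have := ler_wpM2l p_ge0 h; lra.
split.
  by rewrite !pfreeS lerXn2r ?nnegrE ?surv_ge0 ?sm.
rewrite !pdeadS ler_wpM2l ?mulr_ge0 ?ler0n ?p_ge0 // ler_sum // => j _.
have jN := ltn_trans (ltn_ord j) iN.
have [f0 _ _] := law_bounds k jN; have [h0 _ _] := surv_bounds k jN.
have [g0 _ _] := surv_bounds k.+1 jN.
apply: ler_pM; rewrite ?exprn_ge0 //; first by have [] := IH j jN.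
rewrite lerXn2r ?nnegrE //; have := sm j (ltnW jN); lra.
Qed.

(* Discretization of [y' = - y^b], which bounds [surv] from above at every depth. *)
Fixpoint env i : R := if i is i'.+1 then env i' - p * env i' ^+ b else 1.
Definition hazard i : R := b%:R * p * env i ^+ b.-1.
Definition cumh i : R := \sum_(j < i) hazard j.

Hypothesis b0 : (0 < b)%N.
Hypothesis N1 : (1 < N)%N.

Lemma p_lt1 : p < 1.
Proof. by rewrite invf_lt1 ?ltr0n // ltr1n. Qed.

Lemma expr_pred (x : R) : x ^+ b = x * x ^+ b.-1.
Proof. by rewrite -exprS prednK. Qed.

Lemma envSE i : env i.+1 = env i * (1 - p * env i ^+ b.-1).
Proof. by rewrite /= expr_pred; ring. Qed.

Lemma env_bounds i : 0 < env i /\ env i <= 1.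
Proof.
elim: i => [|i [h0 h1]]; first by rewrite /= ltr01.
have e0 : 0 <= env i ^+ b.-1 by rewrite exprn_ge0 // ltW.
have e1 : env i ^+ b.-1 <= 1 by rewrite exprn_ile1 // ltW.
have := mulr_ge0 p_ge0 e0; have := ler_wpM2l p_ge0 e1; have := p_lt1.
move=> A B C; rewrite envSE; split; first by rewrite mulr_gt0 //; lra.
apply: mulr_ile1 => //; [exact: ltW|lra|lra].
Qed.
Lemma env_gt0 i : 0 < env i. Proof. by have [] := env_bounds i. Qed.
Lemma env_ge0 i : 0 <= env i. Proof. exact: ltW (env_gt0 i). Qed.
Lemma env_le1 i : env i <= 1. Proof. by have [] := env_bounds i. Qed.
Lemma env_dec i : env i.+1 <= env i.
Proof. by rewrite /= gerBl mulr_ge0 ?p_ge0 ?exprn_ge0 ?env_ge0. Qed.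

(** [env] solves the recursion in which nothing is undecided, where the dead probability is
    [1 - env ^+ b]; induction on the depth stays on the correct side of this fixed point. The shift
    to [env i.+1] in the bound on [pfree] makes the discretization err in the right direction. *)
Lemma law_env k :
  [/\ forall i, (i <= N)%N -> surv k i <= env i,
      forall i, (i < N)%N -> pdead k i <= 1 - env i ^+ b &
      forall i, (i < N)%N -> pfree k i <= env i.+1 ^+ b].
Proof.
have aux k' : (forall i, (i < N)%N -> pdead k' i <= 1 - env i ^+ b) ->
    forall i, (i <= N)%N -> surv k' i <= env i.
  move=> H; elim=> [|j IHj] jN; first by rewrite surv0.
  rewrite survS /=; have := IHj (ltnW jN); have := H j jN => h.
  have := ler_wpM2l p_ge0 h; lra.
elim: k => [|k [IHs IHd IHf]].
  have H j : (j < N)%N -> pdead 0 j <= 1 - env j ^+ b.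
    by rewrite /pdead /= subr_ge0 exprn_ile1 ?env_ge0 ?env_le1.
  split=> [|//|i iN]; first exact: aux.
  by have -> : pfree 0 i = 0 by []; rewrite exprn_ge0 ?env_ge0.
have H j : (j < N)%N -> pdead k.+1 j <= 1 - env j ^+ b.
  elim: j => [|j IHj] jN; first by rewrite pdeadS0 /= expr1n subrr.
  have jN' := ltnW jN; have {}IHj := IHj jN'.
  have := subrX_ge b (env_ge0 j.+1) (env_dec j).
  rewrite pdeadSS => h.
  suff : b%:R * p * (pfree k j * (surv k j - p) ^+ b.-1) <=
         b%:R * env j.+1 ^+ b.-1 * (env j - env j.+1) by lra.
  have -> : b%:R * env j.+1 ^+ b.-1 * (env j - env j.+1) =
            b%:R * p * ((env j.+1 ^+ b.-1 * env j) * env j ^+ b.-1).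
    have -> : env j - env j.+1 = p * env j ^+ b by rewrite /=; ring.
    by rewrite [env j ^+ b]expr_pred; ring.
  rewrite ler_wpM2l ?mulr_ge0 ?ler0n ?p_ge0 //.
  have [f0 _ _] := law_bounds k jN'.
  have [s0 _ _] := surv_bounds k jN'.
  have ss := IHs j (ltnW jN').
  apply: ler_pM; rewrite ?exprn_ge0 //.
  - apply: le_trans (IHf j jN') _.
    by rewrite expr_pred mulrC ler_wpM2l ?exprn_ge0 ?env_ge0 ?env_dec.
  - rewrite lerXn2r ?nnegrE ?env_ge0 //.
    by have := p_ge0; lra.
split=> [|//|i iN]; first exact: aux.
by rewrite pfreeS lerXn2r ?nnegrE ?surv_ge0 ?env_ge0 ?IHs.
Qed.

Lemma surv_env k i : (i <= N)%N -> surv k i <= env i.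
Proof. by have [h _ _] := law_env k; exact: h. Qed.
Lemma pfree_env k i : (i < N)%N -> pfree k i <= env i.+1 ^+ b.
Proof. by have [_ _ h] := law_env k; exact: h. Qed.

Lemma surv_le1 k i : (i <= N)%N -> surv k i <= 1.
Proof. by move=> iN; apply: le_trans (surv_env k iN) (env_le1 i). Qed.

Lemma pfree_env_pred k i : (i < N)%N -> pfree k i <= env i ^+ b.-1.
Proof.
move=> iN; apply: le_trans (pfree_env k iN) _.
apply: (@le_trans _ _ (env i ^+ b)).
  by rewrite lerXn2r ?nnegrE ?env_ge0 ?env_dec.
by rewrite expr_pred ler_piMl ?exprn_ge0 ?env_ge0 ?env_le1.
Qed.

Lemma hazard_ge0 i : 0 <= hazard i.
Proof. by rewrite !mulr_ge0 ?ler0n ?p_ge0 ?exprn_ge0 ?env_ge0. Qed.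
Lemma cumhS i : cumh i.+1 = cumh i + hazard i.
Proof. by rewrite /cumh big_ord_recr. Qed.
Lemma cumh0 : cumh 0 = 0. Proof. by rewrite /cumh big_ord0. Qed.
Lemma cumh_ge0 i : 0 <= cumh i.
Proof. by apply: sumr_ge0 => j _; apply: hazard_ge0. Qed.
Lemma hazard_le i : hazard i <= b%:R * p.
Proof. by rewrite /hazard ler_piMr ?mulr_ge0 ?ler0n ?p_ge0 ?exprn_ile1 ?env_ge0 ?env_le1. Qed.
Lemma cumh_le i : (i <= N)%N -> cumh i <= b%:R.
Proof.
move=> iN; apply: (@le_trans _ _ (i%:R * (b%:R * p))).
  elim: i {iN} => [|i IH]; first by rewrite cumh0 mul0r.
  by rewrite cumhS -natr1 mulrDl mul1r lerD ?hazard_le.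
by rewrite mulrCA ler_piMr ?ler0n ?mulp_le1.
Qed.
Lemma cumh_mono i j : (i <= j)%N -> cumh i <= cumh j.
Proof.
move=> /subnK <-; elim: (j - i)%N => // m IH.
by rewrite addSn cumhS; have := hazard_ge0 (m + i); lra.
Qed.

Definition punk k i : R := 1 - pfree k i - pdead k i.

Lemma punk_bounds k i : (i < N)%N -> 0 <= punk k i /\ punk k i <= 1.
Proof. by move=> iN; have [] := law_bounds k iN; rewrite /punk => *; split; lra. Qed.

(** Discrete form of [u_(k+1)(s) <= int_0^s h u_k]. The decrease of [surv ^+ b] has a part from free
    children, which reappears as growth of [pdead], and a part from undecided children, which
    remains at rate at most [hazard]. *)
Lemma punkS k i : (i < N)%N ->
  punk k.+1 i <= \sum_(j < i) hazard j * punk k j + b%:R ^+ 2 * p.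
Proof.
move=> iN.
have bp : b%:R = b.-1%:R + 1 :> R by rewrite natr1 prednK.
have key j : (j <= i)%N -> 1 - surv k j ^+ b - pdead k.+1 j <=
    \sum_(l < j) hazard l * punk k l + b%:R * b.-1%:R * p * (j%:R * p).
  elim: j => [|j IHj] ji.
    by rewrite surv0 pdeadS0 expr1n big_ord0 !mul0r mulr0; lra.
  have jN := ltn_trans ji iN; have {}IHj := IHj (ltnW ji).
  have [f0 d0 fd] := law_bounds k jN; have [s0 s1 s2] := surv_bounds k jN.
  have [u0 u1] := punk_bounds k jN; have se := surv_env k (ltnW jN).
  have sj0 := surv_ge0 k (ltnW jN).
  have H1 := subrX_le b (surv_ge0 k jN) s2.
  have sp : surv k j - p <= surv k j by rewrite gerBl p_ge0.
  have H2 := subrX_le b.-1 s0 sp.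
  have H3 : b.-1%:R * surv k j ^+ b.-1.-1 * (surv k j - (surv k j - p)) <= b.-1%:R * p.
    rewrite opprB addrC subrK -mulrA ler_wpM2l ?ler0n //.
    by rewrite ler_piMl ?p_ge0 // exprn_ile1 ?surv_le1 // ltnW.
  have {}H2 := le_trans H2 H3.
  have H4 : b%:R * p * (surv k j ^+ b.-1 * punk k j) <= hazard j * punk k j.
    rewrite mulrA ler_wpM2r // /hazard ler_wpM2l ?mulr_ge0 ?ler0n ?p_ge0 //.
    by rewrite lerXn2r ?nnegrE ?env_ge0.
  (* The cost of ties in one step; over at most [N] steps these add up to [b (b-1) p], and the final
     shift of [surv] from rank [i] to [i.+1] adds [b p], whence [b ^+ 2 * p]. *)
  have H5 : b%:R * p * (pfree k j * (surv k j ^+ b.-1 - (surv k j - p) ^+ b.-1)) <=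
            b%:R * p * (b.-1%:R * p).
    rewrite ler_wpM2l ?mulr_ge0 ?ler0n ?p_ge0 //.
    apply: le_trans H2; apply: ler_piMl; last by lra.
    by rewrite subr_ge0 lerXn2r ?nnegrE.
  rewrite big_ord_recr /= pdeadSS -natr1.
  have E : surv k j - surv k j.+1 = p * (pfree k j + punk k j).
    by rewrite survS /punk; ring.
  rewrite E in H1; set X := surv k j ^+ b.-1 in H1 H4 H5.
  set Y := (surv k j - p) ^+ b.-1 in H5 *.
  set B : R := b%:R in H1 H4 H5 IHj *; set P : R := p in H1 H4 H5 IHj *.
  set Q : R := b.-1%:R in H5 IHj *.
  have E1 : B * X * (P * (pfree k j + punk k j)) =
    B * P * (X * punk k j) + B * P * (pfree k j * (X - Y)) + B * P * (pfree k j * Y).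
    by ring.
  rewrite E1 in H1.
  have -> : B * Q * P * ((j%:R + 1) * P) = B * Q * P * (j%:R * P) + B * P * (Q * P).
    by ring.
  lra.
have K := key i (leqnn _).
have [s0 s1 s2] := surv_bounds k iN.
have sb := surv_ge0 k (ltnW iN).
have H1 := subrX_le b (surv_ge0 k iN) s2.
have H2 : b%:R * surv k i ^+ b.-1 * (surv k i - surv k i.+1) <= b%:R * p.
  apply: ler_pM; rewrite ?mulr_ge0 ?ler0n ?exprn_ge0 //; [lra | | lra].
  by rewrite ler_piMr ?ler0n // exprn_ile1 ?surv_le1 // ltnW.
have H3 : b%:R * b.-1%:R * p * (i%:R * p) <= b%:R * b.-1%:R * p.
  by rewrite ler_piMr ?mulp_le1 ?mulr_ge0 ?ler0n ?p_ge0 // ltnW.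
rewrite /punk pfreeS.
have -> : b%:R ^+ 2 * p = b%:R * b.-1%:R * p + b%:R * p :> R by rewrite bp; ring.
lra.
Qed.

(** A left Riemann sum for the integral of [H^k dH], hence at most [H^(k+1) / (k+1)]. *)
Lemma sum_hazard_cumhX k i :
  \sum_(j < i) hazard j * cumh j ^+ k <= cumh i ^+ k.+1 / k.+1%:R.
Proof.
elim: i => [|i IH]; first by rewrite big_ord0 cumh0 expr0n mul0r.
rewrite big_ord_recr /=.
have le : cumh i <= cumh i.+1 by rewrite cumhS lerDl hazard_ge0.
have := subrX_ge k.+1 (cumh_ge0 i) le.
have -> : cumh i.+1 - cumh i = hazard i by rewrite cumhS addrC addKr.
move=> /= H.
have k0 : 0 < k.+1%:R :> R by rewrite ltr0n.
rewrite ler_pdivlMr // in IH; rewrite ler_pdivlMr //.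
rewrite mulrDl; apply: le_trans (lerD IH (lexx _)) _.
by rewrite -lerBrDl; apply: le_trans H; rewrite le_eqVlt; apply/orP; left; apply/eqP; ring.
Qed.

(** Iterating [punkS] produces the factorial. The tie errors obey [e_(k+1) = K + cumh * e_k], which
    [K * (1 + cumh)^k] dominates. *)
Lemma punk_le k i : (i < N)%N ->
  punk k i <= cumh i ^+ k / k`!%:R + b%:R ^+ 2 * p * (1 + cumh i) ^+ k.
Proof.
have K0 : 0 <= b%:R ^+ 2 * p by rewrite mulr_ge0 ?exprn_ge0 ?ler0n ?p_ge0.
elim: k i => [|k IH] i iN.
  by rewrite /punk /pfree /pdead /= !expr0 fact0 divr1 !subr0 mulr1 lerDl.
apply: le_trans (punkS k iN) _.
set K := b%:R ^+ 2 * p in K0 IH *.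
have c0 := cumh_ge0 i.
have H : \sum_(j < i) hazard j * punk k j <=
    \sum_(j < i) (hazard j * cumh j ^+ k) / k`!%:R +
    \sum_(j < i) hazard j * (K * (1 + cumh i) ^+ k).
  rewrite -big_split /=; apply: ler_sum => j _.
  have jN := ltn_trans (ltn_ord j) iN.
  rewrite -mulrA -mulrDr ler_wpM2l ?hazard_ge0 //; apply: le_trans (IH j jN) _.
  rewrite lerD2l ler_wpM2l // lerXn2r ?nnegrE ?addr_ge0 ?ler01 ?cumh_ge0 //.
  by rewrite lerD2l cumh_mono // ltnW.
rewrite -!mulr_suml in H.
have H2 := sum_hazard_cumhX k i.
have H3 : (\sum_(j < i) hazard j * cumh j ^+ k) / k`!%:R <= cumh i ^+ k.+1 / (k.+1)`!%:R.
  rewrite factS natrM invfM mulrA ler_wpM2r ?invr_ge0 ?ler0n //.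
have H4 : K <= K * (1 + cumh i) ^+ k.
  by rewrite ler_peMr // exprn_ege1 //; lra.
apply: le_trans (lerD H (lexx _)) _.
rewrite -addrA; apply: lerD H3 _.
rewrite [(1 + _) ^+ k.+1]exprS -/(cumh i).
have -> : K * ((1 + cumh i) * (1 + cumh i) ^+ k) =
  cumh i * (K * (1 + cumh i) ^+ k) + K * (1 + cumh i) ^+ k by ring.
by rewrite lerD2l.
Qed.

(* Compares the derivative of [surv^(b+1)], the probability that a vertex with [b+1]
   children is unmatched, with the rate [pfree^2] at which an edge is accepted. *)
Lemma success_ge k T : (T <= N)%N ->
  1 - env T ^+ b.+1 <= b.+1%:R * p * \sum_(i < T) pfree k.+1 i ^+ 2 +
    b.+1%:R / b%:R * \sum_(i < T) hazard i * punk k i + b.+1%:R * b%:R * p * (T%:R * p).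
Proof.
move=> TN.
have b0R : 0 < b%:R :> R by rewrite ltr0n.
have se := surv_env k TN.
apply: (@le_trans _ _ (1 - surv k T ^+ b.+1)).
  by rewrite lerD2l lerN2 lerXn2r ?nnegrE ?env_ge0 ?surv_ge0.
elim: T TN {se} => [|i IH] iN.
  by rewrite surv0 !big_ord0 expr1n !mul0r !mulr0; lra.
have {}IH := IH (ltnW iN).
have [f0 d0 fd] := law_bounds k iN; have [s0 s1 s2] := surv_bounds k iN.
have [u0 u1] := punk_bounds k iN; have [m1 _] := law_mono k iN.
have [F0 _ F1] := law_bounds k.+1 iN.
have sj0 := surv_ge0 k (ltnW iN).
have := subrX_le b.+1 (surv_ge0 k iN) s2.
have -> : surv k i - surv k i.+1 = p * (pfree k i + punk k i).
  by rewrite survS /punk; ring.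
move=> /= H1.
have H2 : surv k i ^+ b <= pfree k.+1 i + b%:R * p.
  rewrite pfreeS -lerBlDl; apply: le_trans (subrX_le b (surv_ge0 k iN) s2) _.
  apply: ler_pM; rewrite ?mulr_ge0 ?ler0n ?exprn_ge0 //; [lra | | lra].
  by rewrite ler_piMr ?ler0n // exprn_ile1 ?surv_le1 // ltnW.
have H3 : b.+1%:R * p * (pfree k.+1 i * punk k i) <= b.+1%:R / b%:R * (hazard i * punk k i).
  have -> : b.+1%:R / b%:R * (hazard i * punk k i) =
            b.+1%:R * p * (env i ^+ b.-1 * punk k i).
    by rewrite /hazard; field; rewrite !pnatr_eq0 -!lt0n N0 b0.
  rewrite ler_wpM2l ?mulr_ge0 ?ler0n ?p_ge0 // ler_wpM2r //.
  exact: pfree_env_pred.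
(* Monotonicity in the depth trades the mixed product for a square, the rate at which both ends are
   certified at the same depth. *)
have H4 : b.+1%:R * p * (pfree k.+1 i * pfree k i) <= b.+1%:R * p * pfree k.+1 i ^+ 2.
  by rewrite expr2 !ler_wpM2l ?mulr_ge0 ?ler0n ?p_ge0.
have H5 : b.+1%:R * p * (surv k i ^+ b * (pfree k i + punk k i)) <=
   b.+1%:R * p * (pfree k.+1 i * pfree k i) + b.+1%:R * p * (pfree k.+1 i * punk k i)
   + b.+1%:R * b%:R * p * p.
  have -> : b.+1%:R * p * (pfree k.+1 i * pfree k i) + b.+1%:R * p * (pfree k.+1 i * punk k i)
   + b.+1%:R * b%:R * p * p = b.+1%:R * p * (pfree k.+1 i * (pfree k i + punk k i) + b%:R * p).
    by ring.
  rewrite ler_wpM2l ?mulr_ge0 ?ler0n ?p_ge0 //.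
  apply: (@le_trans _ _ ((pfree k.+1 i + b%:R * p) * (pfree k i + punk k i))).
    by apply: ler_wpM2r => //; exact: addr_ge0.
  rewrite mulrDl lerD2l ler_piMr ?mulr_ge0 ?ler0n ?p_ge0 //.
  by rewrite /punk; lra.
rewrite !big_ord_recr /= -[i.+1%:R]natr1 [b.+1%:R * p * (_ + _)]mulrDr
  [b.+1%:R / _ * (_ + _)]mulrDr.
have -> : b.+1%:R * b%:R * p * ((i%:R + 1) * p) =
  b.+1%:R * b%:R * p * (i%:R * p) + b.+1%:R * b%:R * p * p by ring.
have E : b.+1%:R * surv k i ^+ b * (p * (pfree k i + punk k i)) =
   b.+1%:R * p * (surv k i ^+ b * (pfree k i + punk k i)) by ring.
rewrite E in H1; lra.
Qed.

(** For [y' = - y^b] the function [y^-(b+1)] has derivative [(b+1) y^-2 >= b+1]. So the free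
    fraction [1/(1+t)] is an upper bound at every degree, not just in the limit of large ones. *)
Lemma env_pow_le T : env T ^+ b.+1 <= (1 + b.+1%:R * p * T%:R)^-1.
Proof.
have D0 i : 0 < 1 + b.+1%:R * p * i%:R.
  by rewrite ltr_wpDr // !mulr_ge0 ?ler0n ?p_ge0.
rewrite -[leLHS]invrK lef_pV2 ?posrE ?invr_gt0 ?exprn_gt0 ?env_gt0 //.
elim: T => [|i IH]; first by rewrite /= expr1n invr1 mulr0 addr0.
set x := p * env i ^+ b.-1.
have e0 := env_gt0 i.
have x0 : 0 < x by rewrite mulr_gt0 ?p_gt0 ?exprn_gt0.
have x1 : 0 < 1 - x.
  by have := env_gt0 i.+1; rewrite envSE -/x pmulr_rgt0.
rewrite envSE -/x exprMn invfM.
(* Bernoulli's inequality after [1 + x <= 1/(1-x)]. *)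
have B : 1 + b.+1%:R * x <= ((1 - x) ^+ b.+1)^-1.
  apply: (@le_trans _ _ ((1 + x) ^+ b.+1)).
    have := @subrX_ge _ b.+1 1 (1 + x) ler01; rewrite !expr1n; move/(_ _).
    have -> : 1 <= 1 + x by lra.
    by move/(_ isT); lra.
  have hA : 0 <= 1 + x by lra.
  have hB : 0 <= (1 - x)^-1 by rewrite invr_ge0 ltW.
  rewrite -exprVn lerXn2r ?nnegrE //.
  by rewrite -[leRHS]mul1r ler_pdivlMr //; have := sqr_ge0 x; rewrite expr2; lra.
have I0 : 0 < (env i ^+ b.+1)^-1 by rewrite invr_gt0 exprn_gt0.
apply: (@le_trans _ _ ((env i ^+ b.+1)^-1 * (1 + b.+1%:R * x))); last first.
  by rewrite ler_pM2l.
set I := (env i ^+ b.+1)^-1 in IH I0 *.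
have -> : I * (1 + b.+1%:R * x) = I + b.+1%:R * p * (I * env i ^+ b.-1).
  by rewrite /x; ring.
have -> : 1 + b.+1%:R * p * i.+1%:R = 1 + b.+1%:R * p * i%:R + b.+1%:R * p.
  by rewrite -[i.+1%:R]natr1; ring.
apply: lerD => //; rewrite ler_peMr ?mulr_ge0 ?ler0n ?p_ge0 // /I.
have -> : (env i ^+ b.+1)^-1 * env i ^+ b.-1 = (env i ^+ 2)^-1.
  have -> : b.+1 = (b.-1 + 2)%N by rewrite addn2 prednK.
  by rewrite exprD invfM mulrC mulrA mulfV ?mul1r // expf_neq0 // gt_eqF.
by rewrite -[leLHS]invr1 lef_pV2 ?posrE ?exprn_gt0 // exprn_ile1 ?env_le1 // ltW.
Qed.

(** The hazard is the logarithmic derivative of [y^-b]; on the grid [1 - x <= exp(-x)] gives the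
    inequality. *)
Lemma expR_cumh_env i : expR (cumh i) * env i ^+ b <= 1.
Proof.
elim: i => [|i IH]; first by rewrite cumh0 expR0 /= expr1n mulr1.
set x := p * env i ^+ b.-1.
have x1 : 0 < 1 - x.
  by have := env_gt0 i.+1; rewrite envSE -/x pmulr_rgt0 ?env_gt0.
rewrite envSE -/x cumhS.
have -> : hazard i = b%:R * x by rewrite /hazard /x; ring.
rewrite expRD exprMn mulrACA.
have x1' := ltW x1.
apply: mulr_ile1 => //; rewrite ?mulr_ge0 ?expR_ge0 ?exprn_ge0 ?env_ge0 //.
rewrite expRM_natl -exprMn exprn_ile1 ?mulr_ge0 ?expR_ge0 //.
have h := expR_ge1Dx (- x).
by rewrite -ler_pdivlMl ?expR_gt0 // mulr1 -expRN; lra.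
Qed.

(** The growth of [y^-b] is split as [y^-1 * y^-(b-1)]: the first factor has derivative
    [y^(b-2) <= 1], the second has derivative [b-1], so both are bounded linearly in time. The
    factor [1/(1 - b p)] pays for the discretization. *)
Lemma env_inv_le i : (1 < b)%N -> b%:R * p < 1 ->
  (env i)^-1 <= 1 + i%:R * (p / (1 - b%:R * p)) /\
  (env i ^+ b.-1)^-1 <= 1 + b.-1%:R * (i%:R * (p / (1 - b%:R * p))).
Proof.
move=> b1 bp1.
have c0 : 0 < 1 - b%:R * p by lra.
elim: i => [|i [IH1 IH2]]; first by rewrite /= expr1n invr1 !mul0r mulr0 addr0.
set x := p * env i ^+ b.-1.
have e0 := env_gt0 i; have e1 := env_le1 i.
have x0 : 0 < x by rewrite mulr_gt0 ?p_gt0 ?exprn_gt0.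
have xp : x <= p by rewrite ler_piMr ?p_ge0 // exprn_ile1 // ltW.
have bx : b.-1%:R * x <= b%:R * p.
  by apply: ler_pM => //; [exact: ltW | rewrite ler_nat leq_pred].
have xx : x <= b%:R * p.
  apply: le_trans bx; apply: ler_peMl; [exact: ltW | by rewrite ler1n -ltnS prednK].
have x1 : 0 < 1 - x by lra.
rewrite envSE -/x exprMn !invfM -natr1; split.
- have -> : (1 - x)^-1 = 1 + x / (1 - x) by field; rewrite gt_eqF.
  rewrite mulrDr mulr1 mulrDl mul1r addrA lerD //.
  have A : 0 <= (env i)^-1 * x by rewrite mulr_ge0 ?invr_ge0 // ltW.
  have B : 0 <= (1 - x)^-1 by rewrite invr_ge0 ltW.
  rewrite mulrA; apply: ler_pM => //.
    rewrite ler_pdivrMl // /x mulrC ler_wpM2r ?p_ge0 //.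
    have -> : b.-1 = b.-2.+1 by rewrite prednK // -ltnS prednK.
    by rewrite exprS ler_piMr ?env_ge0 // exprn_ile1 ?env_ge0.
  by rewrite lef_pV2 ?posrE //; lra.
- set z := (env i ^+ b.-1)^-1 in IH2 *.
  have z0 : 0 < z by rewrite invr_gt0 exprn_gt0.
  have zx : z * x = p.
    by rewrite /z /x mulrCA mulVf ?mulr1 // expf_neq0 // gt_eqF.
  have y0 : 0 < 1 - b.-1%:R * x by lra.
  have H : ((1 - x) ^+ b.-1)^-1 <= (1 - b.-1%:R * x)^-1.
    rewrite lef_pV2 ?posrE ?exprn_gt0 //.
    have xle : 1 - x <= 1 by lra.
    have := subrX_le b.-1 (ltW x1) xle.
    by rewrite !expr1n mulr1; lra.
  apply: (@le_trans _ _ (z * (1 - b.-1%:R * x)^-1)).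
    by rewrite ler_pM2l.
  have -> : z * (1 - b.-1%:R * x)^-1 = z + b.-1%:R * (z * x) / (1 - b.-1%:R * x).
    by field; rewrite gt_eqF.
  rewrite zx mulrDl mul1r mulrDr addrA lerD // -mulrA ler_wpM2l ?ler0n //.
  rewrite ler_wpM2l ?p_ge0 // lef_pV2 ?posrE //; lra.
Qed.

Lemma expR_cumh_le i : (1 < b)%N -> b%:R * p < 1 ->
  expR (cumh i) <= (1 + i%:R * (p / (1 - b%:R * p))) *
                   (1 + b.-1%:R * (i%:R * (p / (1 - b%:R * p)))).
Proof.
move=> b1 bp1; have [H1 H2] := env_inv_le i b1 bp1.
apply: (@le_trans _ _ ((env i ^+ b)^-1)).
  by have := expR_cumh_env i; rewrite -ler_pdivlMr ?exprn_gt0 ?env_gt0 // mul1r.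
rewrite expr_pred invfM.
by apply: ler_pM; rewrite ?invr_ge0 ?exprn_ge0 ?env_ge0.
Qed.

(** Dominates the expected number of visits: [hazard j] bounds the rate of entering a child of rank
    [j]. The sum includes rank [i] itself because ties are explored. *)
Fixpoint vbound k i : R :=
  if k is k'.+1 then 1 + \sum_(j < i.+1) hazard j * vbound k' j else 0.

(** Discrete Gronwall. The summand at [j] already carries the bound at [j.+1]; doubling the exponent
    absorbs this, since [(1 - h)(1 + 2h) >= 1] for [0 <= h <= 1/2]. *)
Lemma vbound_le k i : b%:R * p <= 2^-1 -> vbound k i <= expR (2 * cumh i.+1).
Proof.
move=> bp2; elim: k i => [|k IH] i /=; first exact: expR_ge0.
suff: forall m, 1 + \sum_(j < m) hazard j * vbound k j <= expR (2 * cumh m) by apply.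
elim=> [|m IHm]; first by rewrite big_ord0 cumh0 mulr0 expR0 addr0.
rewrite big_ord_recr /= addrA.
apply: le_trans (lerD IHm (ler_wpM2l (hazard_ge0 m) (IH m))) _.
rewrite cumhS mulrDr expRD; set E := expR (2 * cumh m).
have E0 : 0 < E by exact: expR_gt0.
have h0 := hazard_ge0 m; have h1 := le_trans (hazard_le m) bp2.
set h := hazard m in h0 h1 *; set F := expR (2 * h).
have F1 : 1 + 2 * h <= F by exact: expR_ge1Dx.
have -> : E + h * (E * F) = E * (1 + h * F) by ring.
rewrite ler_pM2l //; have h2 : 0 <= 1 - h by lra.
have := ler_wpM2l h2 F1; have := mulr_ge0 h0 (_ : 0 <= 1 - 2 * h).
by rewrite subr_ge0 -ler_pdivlMl // mulr1 => /(_ h1); lra.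
Qed.

End Law.

(** * Independence under uniform ranks *)

Section Expectation.
Variables (R : realType) (E : finType) (N : nat).
Hypothesis N0 : (0 < N)%N.
Local Notation Om := {ffun E -> 'I_N}.

Definition Ex (X : Om -> R) : R := #|{: Om}|%:R^-1 * \sum_w X w.
(** Measurability with respect to the ranks of the edges in [B]. *)
Definition depends_on (T : Type) (B : {set E}) (X : Om -> T) :=
  forall w w' : Om, {in B, w =1 w'} -> X w = X w'.

Lemma card_ranks_gt0 : 0 < #|{: Om}|%:R :> R.
Proof. by rewrite ltr0n card_ffun expn_gt0 card_ord N0. Qed.

Lemma eq_Ex X Y : X =1 Y -> Ex X = Ex Y.
Proof. by move=> XY; rewrite /Ex (eq_bigr Y). Qed.
Lemma ler_Ex X Y : (forall w, X w <= Y w) -> Ex X <= Ex Y.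
Proof. by move=> XY; rewrite ler_wpM2l ?invr_ge0 ?ler0n // ler_sum. Qed.
Lemma Ex_cst c : Ex (fun=> c) = c.
Proof.
rewrite /Ex sumr_const -[c *+ _]mulr_natl mulrA mulVf ?mul1r //.
by rewrite gt_eqF ?card_ranks_gt0.
Qed.
Lemma ExD X Y : Ex (fun w => X w + Y w) = Ex X + Ex Y.
Proof. by rewrite /Ex big_split mulrDr. Qed.
Lemma ExB X Y : Ex (fun w => X w - Y w) = Ex X - Ex Y.
Proof. by rewrite /Ex sumrB mulrBr. Qed.
Lemma ExZ c X : Ex (fun w => c * X w) = c * Ex X.
Proof. by rewrite /Ex -mulr_sumr mulrCA. Qed.
Lemma Ex_sum (I : Type) (r : seq I) (P : pred I) (X : I -> Om -> R) :
  Ex (fun w => \sum_(i <- r | P i) X i w) = \sum_(i <- r | P i) Ex (X i).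
Proof. by rewrite /Ex exchange_big /= mulr_sumr. Qed.

(* Swapping the coordinates outside [B] between two independent copies is an involution. *)
Lemma Ex_indep (B C : {set E}) X Y : [disjoint B & C] ->
  depends_on B X -> depends_on C Y -> Ex (fun w => X w * Y w) = Ex X * Ex Y.
Proof.
move=> BC dX dY.
pose mix (w w' : Om) : Om := [ffun e => if e \in B then w e else w' e].
have mixX w w' : X (mix w w') = X w.
  by apply: dX => e eB; rewrite ffunE eB.
have mixY w w' : Y (mix w w') = Y w'.
  by apply: dY => e eC; rewrite ffunE (disjointFl BC eC).
pose h (q : Om * Om) := (mix q.1 q.2, mix q.2 q.1).
have hK : involutive h.
  move=> [w w']; congr pair; apply/ffunP => e; rewrite !ffunE /=;
  by case: (e \in B).
have H : (\sum_w X w) * (\sum_w Y w) = #|{: Om}|%:R * \sum_w X w * Y w.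
  rewrite mulr_suml; under eq_bigr do rewrite mulr_sumr.
  rewrite pair_big /=.
  rewrite (eq_bigr (fun q => X (h q).1 * Y (h q).1)); last first.
    by move=> [w w'] _; rewrite /= mixX mixY.
  rewrite -(reindex_inj (P := predT) (F := fun q => X q.1 * Y q.1) (inv_inj hK)).
  rewrite -(pair_big predT predT (fun w w' : Om => X w * Y w)) /= mulr_sumr.
  by apply: eq_bigr => w _; rewrite sumr_const -[_ *+ _]mulr_natl.
rewrite /Ex mulrACA H mulrA; congr (_ * _).
by rewrite mulfVK // gt_eqF ?card_ranks_gt0.
Qed.

Lemma Ex_prod_seq (I : eqType) (s : seq I) (C : I -> {set E}) (X : I -> Om -> R) :
  uniq s -> {in s &, forall i j, i != j -> [disjoint C i & C j]} ->
  {in s, forall i, depends_on (C i) (X i)} ->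
  Ex (fun w => \prod_(i <- s) X i w) = \prod_(i <- s) Ex (X i).
Proof.
elim: s => [|i s IH] /=.
  by move=> *; rewrite big_nil -[RHS]Ex_cst; apply: eq_Ex => w; rewrite big_nil.
move=> /andP[is_ us] dC dX; rewrite big_cons -IH //; last first.
- by move=> j js; apply: dX; rewrite inE js orbT.
- by move=> j l js ls; apply: dC; rewrite inE ?js ?ls orbT.
rewrite -(@Ex_indep (C i) (\bigcup_(j <- s) C j)).
- by apply: eq_Ex => w; rewrite big_cons.
- rewrite disjoint_sym; elim: s is_ us dC {IH dX} => [|j s IHs].
    by rewrite big_nil finset.disjoints_subset finset.sub0set.
  rewrite inE negb_or => /andP[ij is_] /= /andP[_ us] dC.
  rewrite big_cons -finset.setI_eq0 finset.setIUl finset.setU_eq0 !finset.setI_eq0.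
  apply/andP; split.
    by apply: dC; rewrite ?inE ?eqxx ?orbT // eq_sym.
  apply: IHs => // a c; rewrite !inE => /orP[/eqP->|aS] /orP[/eqP->|cS] ac;
  by apply: dC => //; rewrite !inE ?eqxx ?aS ?cS ?orbT.
- by apply: dX; rewrite inE eqxx.
move=> w w' ww'; rewrite big_seq [RHS]big_seq; apply: eq_bigr => j js.
apply: (dX j); first by rewrite inE js orbT.
by move=> e eC; apply: ww'; rewrite (big_rem j) //= inE eC.
Qed.

Lemma Ex_prod (I : finType) (A : {set I}) (C : I -> {set E}) (X : I -> Om -> R) :
  {in A &, forall i j, i != j -> [disjoint C i & C j]} ->
  {in A, forall i, depends_on (C i) (X i)} ->
  Ex (fun w => \prod_(i in A) X i w) = \prod_(i in A) Ex (X i).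
Proof.
move=> dC dX; rewrite -big_enum -(@Ex_prod_seq _ (enum A) C).
- by apply: eq_Ex => w; rewrite big_enum.
- exact: enum_uniq.
- by move=> i j; rewrite !mem_enum; exact: dC.
- by move=> i; rewrite mem_enum; exact: dX.
Qed.

Lemma Ex_value (e : E) (j : 'I_N) : Ex (fun w => (w e == j)%:R) = N%:R^-1.
Proof.
have same i : Ex (fun w => (w e == i)%:R) = Ex (fun w => (w e == j)%:R).
  rewrite /Ex; congr (_ * _).
  pose h (w : Om) : Om := [ffun a => if a == e then tperm i j (w a) else w a].
  have hK : involutive h.
    by move=> w; apply/ffunP => a; rewrite !ffunE; case: eqP => // _; rewrite tpermK.
  rewrite [RHS](reindex_inj (inv_inj hK)) /=.
  apply: eq_bigr => w _; rewrite ffunE eqxx; congr (nat_of_bool _)%:R.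
  by rewrite -{2}(tpermL i j) (inj_eq perm_inj).
have : \sum_i Ex (fun w => (w e == i)%:R) = 1.
  rewrite -Ex_sum -[RHS]Ex_cst; apply: eq_Ex => w.
  rewrite (bigD1 (w e)) //= eqxx big1 ?addr0 // => i /negbTE.
  by rewrite eq_sym => ->.
rewrite (eq_bigr (fun=> Ex (fun w => (w e == j)%:R))); last by move=> i _.
rewrite sumr_const card_ord -[_ *+ _]mulr_natl => /(canRL (mulKf _)) ->.
  by rewrite mulr1.
by rewrite pnatr_eq0 -lt0n.
Qed.

(** Conditioning on the rank of [e]. [H] is indexed by a rank because a search takes as its
    threshold the rank of the edge by which it enters. *)
Lemma Ex_rank (e : E) (B : {set E}) (H : nat -> Om -> R) : e \notin B ->
  (forall j, depends_on B (H j)) ->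
  Ex (fun w => H (w e) w) = N%:R^-1 * \sum_(j < N) Ex (H j).
Proof.
move=> eB dH.
rewrite (eq_Ex (Y := fun w => \sum_(j < N) (w e == j)%:R * H j w)); last first.
  move=> w; rewrite (bigD1 (w e)) //= eqxx mul1r big1 ?addr0 // => i /negbTE.
  by rewrite eq_sym => ->; rewrite mul0r.
rewrite Ex_sum mulr_sumr; apply: eq_bigr => j _.
rewrite (@Ex_indep [set e] B) ?Ex_value //.
- by rewrite disjoints1.
- by move=> w w' ww'; rewrite ww' ?inE.
Qed.

End Expectation.

(** * Non-backtracking walks and girth *)

Section Walks.
Local Open Scope nat_scope.
Variables (n : nat) (G : graph n).
Implicit Types (s t : seq 'I_n) (x y u v w : 'I_n).

Fixpoint nbwalk s : bool :=
  match s with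
  | x :: ((y :: t') as t) =>
      [&& adj G x y, (if t' is z :: _ then x != z else true) & nbwalk t]
  | _ => true
  end.

Lemma nbwalk_cat s x y t :
  nbwalk (s ++ [:: x; y]) -> nbwalk (x :: y :: t) -> nbwalk (s ++ x :: y :: t).
Proof.
elim: s => [//|a [|c s] IH].
  by move=> /and3P[h1 h2 _] h; apply/and3P; split.
move=> /and3P[h1 h2 h3] h; apply/and3P; split => //; last exact: IH.
by case: s h2 {IH h3}.
Qed.

Lemma nbwalk_rev s : nbwalk s -> nbwalk (rev s).
Proof.
elim: s => [//|x [|y [|z s]] IH] //.
  by rewrite /= !andbT adj_sym.
move=> /and3P[h1 h2 h3]; have := IH h3.
rewrite !rev_cons -!cats1 -!catA /= => h; apply: nbwalk_cat => //.
case/and3P: h3 => h3 _ _ /=.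
by rewrite [adj G z y]adj_sym [adj G y x]adj_sym h1 h3 eq_sym h2.
Qed.

Lemma nbwalk_rcons s x : nbwalk (rcons s x) -> nbwalk s.
Proof.
elim: s => [//|y [|z s] IH] // /and3P[h1 h2 /IH h3]; apply/and3P; split => //.
by case: s h2 {IH h3}.
Qed.

Lemma nbwalk_path x s : nbwalk (x :: s) -> path (adj G) x s.
Proof. by elim: s x => [//|y s IH] x /and3P[h1 _ /IH h2]; rewrite /= h1. Qed.

(* The first return of a non-backtracking walk to a vertex closes a cycle. *)
Lemma nbwalk_uniq (L : nat) s : (forall c, is_cycle G c -> (L < size c)%N) ->
  (size s <= L.+1)%N -> nbwalk s -> uniq s.
Proof.
move=> HL; elim: s => [//|x s IH] sL nb; rewrite cons_uniq.
have nbs : nbwalk s by case: s nb {IH sL} => // y s /and3P[].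
have us := IH (ltnW sL) nbs; rewrite us andbT.
apply/negP => xs; have ps := nbwalk_path nb.
case/splitPr: xs nb sL us ps {IH nbs} => s1 s2 nb sL us ps.
have: is_cycle G (x :: s1).
  split; last first.
    apply/andP; split.
      by rewrite /= rcons_path; move: ps; rewrite cat_path /= => /and3P[-> ->].
    move: us; rewrite cat_uniq => /and3P[u1 /hasPn h _] /=.
    by rewrite u1 andbT; apply: h; rewrite inE eqxx.
  case: s1 nb {sL us ps} => [|y [|z s1]] //=.
    by rewrite adj_irrefl.
  by rewrite eqxx /= andbF.
move/HL; rewrite ltnNge => /negP; apply.
by move: sL; rewrite /= size_cat /= addnS !ltnS; apply: leq_trans; rewrite ltnS leq_addr.
Qed.

Definition children v p : {set 'I_n} := neighbors G v :\ p.

Lemma in_children v p w : (w \in children v p) = (w != p) && adj G v w.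
Proof. by rewrite !inE. Qed.

Lemma card_children d v p : regular G d.+1 -> adj G v p -> #|children v p| = d.
Proof.
move=> /(_ v) h vp; move: h; rewrite (cardsD1 p) inE vp /=.
by move=> [].
Qed.

(** The edges whose ranks can influence the search of depth [k] at [v] entered from [p]. *)
Fixpoint branch k v p : {set {set 'I_n}} :=
  if k is k'.+1 then
    \bigcup_(w in children v p) ([set v; w] |: branch k' w v)
  else finset.set0.

Lemma branch_walk k v p e : adj G p v -> e \in branch k v p ->
  exists s c, [/\ nbwalk (p :: v :: rcons s c), (size s < k)%N & e = [set last v s; c]].
Proof.
elim: k v p => [|k IH] v p pv /=; first by rewrite inE.
case/bigcupP => w; rewrite in_children => /andP[wp vw].
rewrite !inE => /orP[/eqP->|].
  by exists [::], w; split=> //=; rewrite pv vw eq_sym wp.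
case/(IH w v vw) => s [c [h1 h2 ->]]; exists (w :: s), c; split => //.
by apply/and3P; split => //; rewrite eq_sym.
Qed.

Lemma twig_walk k v w e : adj G v w -> e \in [set v; w] |: branch k w v ->
  exists s c, [/\ nbwalk (v :: rcons s c), head c s = w, (size s <= k)%N
    & e = [set last v s; c]].
Proof.
move=> vw; rewrite !inE => /orP[/eqP->|].
  by exists [::], w; split=> //=; rewrite vw.
by case/(branch_walk vw) => s [c [h1 h2 ->]]; exists (w :: s), c.
Qed.

(** A common edge would be the last edge of two walks leaving [v] through different neighbors.
    Reversing one and gluing at [v] gives a non-backtracking walk on at most [2(k+1) + 1] vertices
    with a repetition. *)
Lemma twig_disjoint k v w w' :
  (forall c, is_cycle G c -> (k.+1.*2 < size c)%N) ->
  adj G v w -> adj G v w' -> w != w' ->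
  [disjoint [set v; w] |: branch k w v & [set v; w'] |: branch k w' v].
Proof.
move=> HL vw vw' ww'; apply/pred0P => e /=; apply/negP => /andP[].
case/(twig_walk vw) => s [c [h1 h2 h3 ->]].
case/(twig_walk vw') => t [a [g1 g2 g3 E]].
have : nbwalk (rev (rcons s c) ++ v :: rcons t a).
  have : nbwalk (rev (v :: rcons s c)) by exact: nbwalk_rev.
  have [r Er] : exists r, rev (rcons s c) = rcons r w.
    case: s h2 {h1 h3 E} => [|x s] /= E; first by exists [::]; rewrite E.
    by exists (rev (rcons s c)); rewrite rev_cons E.
  rewrite rev_cons Er cat_rcons -[rcons (rcons r w) v]cats1 cat_rcons => h.
  apply: nbwalk_cat h _; apply/and3P; split; rewrite ?[adj G w v]adj_sym //.
  by case: t g2 {g1 g3 E} => [|x t] /= ->.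
move/(nbwalk_uniq HL).
rewrite size_cat size_rev /= !size_rcons => /(_ _)/wrap[].
  lia.
rewrite cat_uniq => /and3P[_ /hasPn h /= /andP[va ua]].
have : a \in [set last v s; c] by rewrite E !inE eqxx orbT.
have at_ : a \in v :: rcons t a by rewrite inE mem_rcons inE eqxx orbT.
have := h _ at_; rewrite mem_rev mem_rcons inE negb_or => /andP[ac as_].
rewrite !inE (negbTE ac) orbF => /eqP al.
have: last v s \in v :: s by exact: mem_last.
rewrite -al inE (negbTE as_) orbF => /eqP av.
by rewrite -av mem_rcons inE eqxx in va.
Qed.

Lemma edge_notin_branch k u v :
  (forall c, is_cycle G c -> (k.+1 < size c)%N) -> adj G u v ->
  [set u; v] \notin branch k u v.
Proof.
move=> HL uv; apply/negP; rewrite adj_sym in uv.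
case/(branch_walk uv) => s [c [h1 h2 E]].
have /= := nbwalk_uniq HL _ h1; rewrite size_rcons !ltnS => /(_ h2).
rewrite inE !mem_rcons !inE !negb_or => /and3P[/and3P[_ vc _] /andP[uc _] _].
have : c \in [set u; v] by rewrite E !inE eqxx orbT.
by rewrite !inE ![c == _]eq_sym (negbTE vc) (negbTE uc).
Qed.

Lemma branch_disjoint k u v :
  (forall c, is_cycle G c -> (k.*2 < size c)%N) -> adj G u v ->
  [disjoint branch k u v & branch k v u].
Proof.
move=> HL uv; apply/pred0P => e /=; apply/negP => /andP[].
have vu : adj G v u by rewrite adj_sym.
case/(branch_walk vu) => s [c [h1 h2 ->]].
case/(branch_walk uv) => t [a [g1 g2 E]].
(* Dropping the last vertex [a] of the second walk keeps the glued walk within [2k + 1] vertices, so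
   cycles longer than [2k] suffice. *)
have : nbwalk (rev (rcons s c) ++ u :: v :: t).
  have : nbwalk (rev (v :: u :: rcons s c)) by exact: nbwalk_rev.
  rewrite !rev_cons -!cats1 -!catA; move/nbwalk_cat; apply.
  exact: (@nbwalk_rcons (u :: v :: t) a).
move/(nbwalk_uniq HL).
rewrite size_cat size_rev /= !size_rcons => /(_ _)/wrap[].
  lia.
rewrite cat_uniq => /and3P[_ /hasPn h /= /and3P[ua va ut]].
have : last v t \in [set last u s; c] by rewrite E !inE eqxx.
have lt : last v t \in v :: t by exact: mem_last.
have lt' : last v t \in [:: u, v & t] by rewrite inE lt orbT.
have := h _ lt'; rewrite mem_rev mem_rcons inE negb_or => /andP[ac as_].
rewrite !inE (negbTE ac) orbF => /eqP al.
have: last u s \in u :: s by exact: mem_last.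
rewrite -al inE (negbTE as_) orbF => /eqP av.
by rewrite av (negbTE ua) in lt.
Qed.

End Walks.

(** * The local status of a vertex *)

Section Local.
Variables (n N : nat) (G : graph n).
Local Notation Om := {ffun {set 'I_n} -> 'I_N}.
Implicit Types (w : Om) (u v x y p : 'I_n) (i j k : nat).

Definition rk w u v : nat := w [set u; v].

Lemma rkC w u v : rk w u v = rk w v u.
Proof. by rewrite /rk finset.setUC. Qed.

(** [x] is the neighbor to which greedy matches the vertex before rank [i]; a sibling of equal rank
    disqualifies it. *)
Definition taker (s : 'I_n -> option bool) (r : 'I_n -> nat) (A : {set 'I_n}) i x :=
  [&& (r x < i)%N, s x == Some true &
    [forall y in A :\ x, (r x < r y)%N || (r y < r x)%N && (s y == Some false)]].

(* [p] is the neighbor from which [v] is explored and [i] the rank of the edge [vp].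
   [Some true]: [v] is certified free before rank [i]; [Some false]: certified matched;
   [None]: undecided at depth [k].  Ties only ever make a vertex undecided. *)
Fixpoint status w k v p i : option bool :=
  if k is k'.+1 then
    let s x := status w k' x v (rk w v x) in
    if [forall x in children G v p, (rk w v x <= i)%N ==> (s x == Some false)]
    then Some true
    else if [exists x in children G v p, taker s (rk w v) (children G v p) i x]
    then Some false else None
  else None.

Definition cstatus w k v x := status w k x v (rk w v x).

Lemma status_freeE w k v p i : (status w k.+1 v p i == Some true) =
  [forall x in children G v p, (i.+1 <= rk w v x)%N || (cstatus w k v x == Some false)].
Proof.
rewrite /=; set b1 := [forall x in _, _]; set b2 := [forall x in _, _].
have -> : b1 = b2.
  apply: eq_forallb => x; case: (x \in _) => //=.
  by rewrite implybE -ltnNge.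
by case: b2 => //; case: ifP.
Qed.

Lemma status_deadE w k v p i : (status w k.+1 v p i == Some false) =
  [exists x in children G v p, taker (cstatus w k v) (rk w v) (children G v p) i x].
Proof.
rewrite /=; case: ifP => [/forallP H|_]; last by case: ifP.
apply/esym/negbTE/negP => /existsP[x /andP[xc /and3P[xi /eqP sx _]]].
by have := H x; rewrite xc (ltnW xi) /= -/(cstatus w k v x) sx.
Qed.

(** Valid on every graph and between different depths, which is what makes the output a matching
    without any girth. The symmetric statement is needed for induction, as the two roles swap at
    each level. *)
Lemma free_dead w k l v p i :
  ~ (status w k v p i = Some true /\ status w l v p i = Some false).
Proof.
suff H : forall k l v p i,
  ~ (status w k v p i = Some true /\ status w l v p i = Some false) /\
  ~ (status w k v p i = Some false /\ status w l v p i = Some true).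
  by have [] := H k l v p i.
elim=> {l v p i} [|k' IH] [|l] v p i; split; try by case.
- move=> [/eqP f /eqP d]; move: f d; rewrite status_freeE status_deadE.
  move=> /forallP f /existsP[x /andP[xc /and3P[xi /eqP sx _]]].
  have := f x; rewrite xc ltnNge (ltnW xi) /= => /eqP dx.
  by have [_] := IH l x v (rk w v x); apply.
- move=> [/eqP d /eqP f]; move: f d; rewrite status_freeE status_deadE.
  move=> /forallP f /existsP[x /andP[xc /and3P[xi /eqP sx _]]].
  have := f x; rewrite xc ltnNge (ltnW xi) /= => /eqP dx.
  by have [h _] := IH l x v (rk w v x); apply: h.
Qed.

(* An upper bound on the number of probes of the search: a child is entered only if all
   siblings of smaller rank are certified matched. *)
Fixpoint visits w k v p i : nat :=
  if k is k'.+1 then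
    (\sum_(x in children G v p | (rk w v x < i.+1)%N &&
        [forall y in children G v p :\ x,
          (rk w v x <= rk w v y)%N || (cstatus w k' v y == Some false)])
       visits w k' x v (rk w v x)).+1
  else 0.

Definition twig k v x := [set v; x] |: branch G k x v.

Lemma twig_branch k v p x : x \in children G v p -> twig k v x \subset branch G k.+1 v p.
Proof. by move=> xc; apply: (finset.bigcup_sup x). Qed.

Lemma status_depends k v p i : depends_on (branch G k v p) (fun w => status w k v p i).
Proof.
elim: k v p i => [|k IH] v p i w w' ww' //.
have ch x : x \in children G v p ->
    rk w v x = rk w' v x /\ cstatus w k v x = cstatus w' k v x.
  move=> xc; have /fintype.subsetP sub := twig_branch k xc.
  have E : rk w v x = rk w' v x.
    by rewrite /rk ww' //; apply: sub; rewrite !inE eqxx.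
  split=> //; rewrite /cstatus E; apply: IH => e eb; apply: ww'; apply: sub.
  by rewrite inE eb orbT.
have F : (status w k.+1 v p i == Some true) = (status w' k.+1 v p i == Some true).
  rewrite !status_freeE; apply: eq_forallb => x.
  by case xc: (x \in _) => //=; have [-> ->] := ch x xc.
have D : (status w k.+1 v p i == Some false) = (status w' k.+1 v p i == Some false).
  rewrite !status_deadE; apply: eq_existsb => x.
  case xc: (x \in _) => //=; have [E1 E2] := ch x xc.
  rewrite /taker E1 E2; congr [&& _, _ & _]; apply: eq_forallb => y.
  rewrite inE; case yc: (y \in children G v p); rewrite ?andbF //=.
  by have [-> ->] := ch y yc.
by move: F D; case: (status w k.+1 v p i) => [[]|]; case: (status w' k.+1 v p i) => [[]|].
Qed.

Lemma cstatus_depends k v x : depends_on (twig k v x) (fun w => cstatus w k v x).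
Proof.
move=> w w' ww'; rewrite /cstatus.
have -> : rk w v x = rk w' v x by rewrite /rk ww' // !inE eqxx.
by apply: status_depends => e eb; apply: ww'; rewrite inE eb orbT.
Qed.

Lemma rk_depends k v x : depends_on (twig k v x) (fun w => rk w v x).
Proof. by move=> w w' ww'; rewrite /rk ww' // !inE eqxx. Qed.

Lemma visits_depends k v p i : depends_on (branch G k v p) (fun w => visits w k v p i).
Proof.
elim: k v p i => [|k IH] v p i w w' ww' //=.
have ch x : x \in children G v p ->
    [/\ rk w v x = rk w' v x, cstatus w k v x = cstatus w' k v x &
       visits w k x v (rk w v x) = visits w' k x v (rk w' v x)].
  move=> xc; have /fintype.subsetP sub := twig_branch k xc.
  have ww'' : {in twig k v x, w =1 w'} by move=> e /sub; exact: ww'.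
  have E := rk_depends ww''.
  split=> //; first exact: (cstatus_depends ww''); rewrite E; apply: IH => e eb.
  by apply: ww''; rewrite inE eb orbT.
congr _.+1; apply: eq_big => [x|x /andP[xc _]]; last by have [] := ch x xc.
case xc: (x \in _) => //=; have [-> _ _] := ch x xc; congr (_ && _).
apply: eq_forallb => y; rewrite inE; case yc: (y \in children G v p); rewrite ?andbF //=.
by have [-> -> _] := ch y yc.
Qed.

(** * Law of the search under large girth *)

Variables (R : realType) (b : nat).
Hypothesis N0 : (0 < N)%N.
Hypothesis Greg : regular G b.+1.
Local Notation E := (@Ex R {set 'I_n} N).
Local Notation pr := (N%:R^-1 : R).
Local Notation pf := (@pfree R N b).
Local Notation pd := (@pdead R N b).
Local Notation sv := (@surv R N b).

Lemma prod_forall (A : {set 'I_n}) (P : pred 'I_n) :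
  ([forall x in A, P x])%:R = \prod_(x in A) (P x)%:R :> R.
Proof.
case: (boolP [forall x in A, P x]) => [/forall_inP H|].
  by rewrite big1 // => x /H ->.
rewrite negb_forall => /existsP[x]; rewrite negb_imply => /andP[xA /negbTE Px].
by rewrite (bigD1 x) //= Px mul0r.
Qed.

Definition big_girth k := forall c, is_cycle G c -> (k.*2 < size c)%N.

Lemma big_girthW k l : (l <= k)%N -> big_girth k -> big_girth l.
Proof. by move=> lk H c /H; apply: leq_ltn_trans; rewrite leq_double. Qed.

Lemma edge_notin_twig k v x : big_girth k.+1 -> adj G v x -> [set v; x] \notin branch G k x v.
Proof.
move=> H vx; rewrite finset.setUC; apply: edge_notin_branch; last by rewrite adj_sym.
by move=> c /H; apply: leq_ltn_trans; rewrite doubleS; lia.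
Qed.

Lemma Ex_twigs k v p x (X : Om -> R) (Y : 'I_n -> Om -> R) :
  big_girth k.+1 -> x \in children G v p ->
  depends_on (twig k v x) X -> (forall y, depends_on (twig k v y) (Y y)) ->
  E (fun w => X w * \prod_(y in children G v p :\ x) Y y w) =
  E X * \prod_(y in children G v p :\ x) E (Y y).
Proof.
move=> H xc dX dY.
pose g y := if y == x then X else Y y.
have gE w : X w * \prod_(y in children G v p :\ x) Y y w =
    \prod_(y in children G v p) g y w.
  rewrite [RHS](big_setD1 x) //= /g eqxx; congr (_ * _); apply: eq_bigr => y.
  by rewrite !inE => /andP[/negbTE ->].
rewrite (eq_Ex gE) (@Ex_prod _ _ _ N0 _ _ (twig k v)).
- rewrite [LHS](big_setD1 x) //= /g eqxx; congr (_ * _); apply: eq_bigr => y.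
  by rewrite !inE => /andP[/negbTE ->].
- move=> y z; rewrite !in_children => /andP[_ vy] /andP[_ vz] yz.
  exact: twig_disjoint.
- by move=> y _; rewrite /g; case: eqP => [->|].
Qed.

Lemma Ex_child k v x (X : nat -> Om -> R) : big_girth k.+1 -> adj G v x ->
  (forall j, depends_on (branch G k x v) (X j)) ->
  E (fun w => X (rk w v x) w) = pr * \sum_(j < N) E (X j).
Proof. by move=> H vx dX; apply: Ex_rank => //; apply: edge_notin_twig. Qed.

Lemma Ex_child_point k v x j (X : Om -> R) : big_girth k.+1 -> adj G v x -> (j < N)%N ->
  depends_on (branch G k x v) X ->
  E (fun w => (rk w v x == j)%:R * X w) = pr * E X.
Proof.
move=> H vx jN dX; rewrite (Ex_indep (B := [set [set v; x]]) (C := branch G k x v) N0) //.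
- by rewrite (Ex_value _ N0 _ (Ordinal jN)).
- by rewrite disjoints1 edge_notin_twig.
- by move=> w w' ww'; rewrite /rk ww' ?inE.
Qed.

Lemma sum_surv k j0 : (j0 <= N)%N ->
  pr * \sum_(j < N) (if (j0 <= j)%N then 1 else pd k j) = sv k j0.
Proof.
move=> jN.
rewrite (eq_bigr (fun j : 'I_N => 1 - (if (j < j0)%N then 1 - pd k j else 0))); last first.
  by move=> j _; rewrite ltnNge; case: leqP => _ /=; rewrite ?subr0 // opprB addrC subrK.
rewrite sumrB sumr_const card_ord -big_mkcond /=.
rewrite -(big_ord_widen _ (fun j => 1 - pd k j) jN) /surv mulrBr mulVf //.
by rewrite pnatr_eq0 -lt0n.
Qed.

Definition has_status_law k := forall v p i, adj G v p -> (i < N)%N ->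
  E (fun w => (status w k v p i == Some true)%:R) = pf k i /\
  E (fun w => (status w k v p i == Some false)%:R) = pd k i.

Lemma Ex_later_or_dead k v x j0 : big_girth k.+1 -> has_status_law k -> adj G v x -> (j0 <= N)%N ->
  E (fun w => ((j0 <= rk w v x)%N || (cstatus w k v x == Some false))%:R) = sv k j0.
Proof.
move=> H L vx jN.
rewrite (@Ex_child k v x (fun j w => ((j0 <= j)%N || (status w k x v j == Some false))%:R)) //.
  rewrite -sum_surv //; congr (_ * _); apply: eq_bigr => j _.
  case: leqP => _ /=; first by rewrite Ex_cst.
  by have [|_ ->] := L x v j _ (ltn_ord j); rewrite // adj_sym.
by move=> j w w' ww'; rewrite (status_depends _ ww').
Qed.

Lemma Ex_ne_or_dead k v x j0 : big_girth k.+1 -> has_status_law k -> adj G v x -> (j0 < N)%N ->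
  E (fun w => ((j0 < rk w v x)%N || (rk w v x < j0)%N && (cstatus w k v x == Some false))%:R)
  = sv k j0 - pr.
Proof.
move=> H L vx jN; rewrite -(Ex_later_or_dead H L vx (ltnW jN)).
have := @Ex_child_point k v x j0 (fun=> 1) H vx jN; rewrite Ex_cst // mulr1 => <- //.
rewrite -ExB; apply: eq_Ex => w; rewrite mulr1.
by case: ltngtP => //= _; rewrite ?subr0 ?subrr.
Qed.

(** Distinct children read disjoint sets of ranks, so being free is a product over children, and
    being matched is a disjoint union over the taker and its rank; this reproduces [law] exactly,
    ties included. *)
Lemma status_law k : big_girth k -> has_status_law k.
Proof.
elim: k => [|k IH] H v p i vp iN.
  rewrite /pfree /pdead /=; split; rewrite -[RHS](@Ex_cst R {set 'I_n} N N0 0);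
  exact: eq_Ex.
have L := IH (big_girthW (leqnSn k) H).
have card_ch : #|children G v p| = b by exact: card_children.
split.
  under eq_Ex do rewrite status_freeE prod_forall.
  rewrite (@Ex_prod _ _ _ N0 _ _ (twig k v)).
  - rewrite (eq_bigr (fun=> sv k i.+1)) ?prodr_const ?card_ch //.
    by move=> x; rewrite in_children => /andP[_ vx]; exact: Ex_later_or_dead.
  - move=> y z; rewrite !in_children => /andP[_ vy] /andP[_ vz] yz.
    exact: twig_disjoint.
  - by move=> x _ w w' ww'; rewrite (rk_depends ww') (cstatus_depends ww').
pose T x j w := ((rk w v x == j)%:R * (status w k x v j == Some true)%:R) *
  \prod_(y in children G v p :\ x)
     ((j < rk w v y)%N || (rk w v y < j)%N && (cstatus w k v y == Some false))%:R : R.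
have TE w x : (taker (cstatus w k v) (rk w v) (children G v p) i x)%:R =
   \sum_(j < i) T x j w.
  rewrite /taker; case: (ltnP (rk w v x) i) => ri; last first.
    rewrite big1 // => j _; rewrite /T.
    by rewrite gtn_eqF ?mul0r // (leq_trans (ltn_ord j) ri).
  rewrite (bigD1 (Ordinal ri)) //= big1 ?addr0.
    by rewrite /T eqxx mul1r -/(cstatus w k v x) -mulnb natrM prod_forall.
  move=> j; rewrite -val_eqE /= eq_sym => /negbTE ne; by rewrite /T ne !mul0r.
(* There is at most one taker: two of them would both be certified free, and each would need the
   strictly smaller rank. *)
have DE w : (status w k.+1 v p i == Some false)%:R =
    \sum_(x in children G v p) \sum_(j < i) T x j w.
  rewrite status_deadE; under eq_bigr do rewrite -TE.
  case: (boolP [exists x in _, _]) => [/existsP[x /andP[xc tx]]|].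
    rewrite (big_setD1 x) //= tx big1 ?addr0 // => y; rewrite inE => /andP[].
    rewrite inE => yx yc; apply/eqP; rewrite pnatr_eq0 eqb0; apply/negP => ty.
    case/and3P: tx => _ /eqP sx /forallP /(_ y); rewrite !inE yx.
    rewrite -[(y != p) && _]in_children yc /=.
    case/and3P: ty => _ /eqP sy /forallP /(_ x); rewrite !inE eq_sym yx.
    rewrite -[(x != p) && _]in_children xc /= sx sy !andbF !orbF.
    by move=> h1 h2; have := ltn_trans h1 h2; rewrite ltnn.
  rewrite negb_exists => /forallP H0; rewrite big1 // => x xc.
  by have := H0 x; rewrite xc /= => /negbTE ->.
rewrite (eq_Ex DE) Ex_sum pdeadS.
rewrite (eq_bigr (fun=> \sum_(j < i) pr * pf k j * (sv k j - pr) ^+ b.-1)); last first.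
  move=> x xc; have := xc; rewrite in_children => /andP[_ vx].
  rewrite Ex_sum; apply: eq_bigr => j _; have jN := ltn_trans (ltn_ord j) iN.
  rewrite /T (@Ex_twigs k v p x) //.
  - rewrite (@Ex_child_point k v x) //; last first.
      by move=> w w' ww'; rewrite (status_depends _ ww').
    have [|-> _] := L x v j _ jN; first by rewrite adj_sym.
    rewrite (eq_bigr (fun=> sv k j - pr)); last first.
      by move=> y; rewrite !inE => /and3P[_ _ vy]; exact: Ex_ne_or_dead.
    rewrite prodr_const; congr (_ * _ ^+ _); move: card_ch.
    by rewrite (cardsD1 x) xc => <-.
  - move=> w w' ww'; rewrite (rk_depends ww').
    rewrite (@status_depends k x v j w w') // => e eb.
    by apply: ww'; rewrite inE eb orbT.
  - by move=> y w w' ww'; rewrite (rk_depends ww') (cstatus_depends ww').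
rewrite sumr_const card_ch -[_ *+ b]mulr_natl -[RHS]mulrA; congr (_ * _).
by rewrite mulr_sumr; apply: eq_bigr => j _; rewrite mulrA.
Qed.

Hypothesis b0 : (0 < b)%N.
Hypothesis N1 : (1 < N)%N.

(** A child of rank [j] is entered when its [b.-1] siblings are later or dead, with probability
    [surv ^+ b.-1], independently of the cost below it. Passing to [env] makes this rate independent
    of the depth. *)
Lemma Ex_visits k v p i : big_girth k -> adj G v p -> (i < N)%N ->
  E (fun w => (visits w k v p i)%:R) <= @vbound R N b k i.
Proof.
elim: k v p i => [|k IH] v p i H vp iN; first by rewrite /= Ex_cst.
have Hk := big_girthW (leqnSn k) H; have L := status_law Hk.
have card_ch : #|children G v p| = b by exact: card_children.
pose T x j w := ((rk w v x == j)%:R * (visits w k x v j)%:R) *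
  \prod_(y in children G v p :\ x)
     ((j <= rk w v y)%N || (cstatus w k v y == Some false))%:R : R.
have VE w : (visits w k.+1 v p i)%:R =
    1 + \sum_(x in children G v p) \sum_(j < i.+1) T x j w.
  rewrite /= -natr1 addrC natr_sum; congr (_ + _).
  rewrite big_mkcondr /=; apply: eq_bigr => x _.
  case: (ltnP (rk w v x) i.+1) => ri /=; last first.
    rewrite big1 // => j _; rewrite /T.
    by rewrite gtn_eqF ?mul0r // (leq_trans (ltn_ord j) ri).
  rewrite (bigD1 (Ordinal ri)) //= big1 ?addr0.
    by rewrite /T eqxx mul1r -prod_forall; case: [forall y in _, _]; rewrite ?mulr1 ?mulr0.
  move=> j; rewrite -val_eqE /= eq_sym => /negbTE ne; by rewrite /T ne !mul0r.
rewrite (eq_Ex VE) ExD Ex_cst // lerD2l Ex_sum.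
apply: (@le_trans _ _ (\sum_(x in children G v p) \sum_(j < i.+1)
   pr * @vbound R N b k j * @env R N b j ^+ b.-1)).
  apply: ler_sum => x xc; have := xc; rewrite in_children => /andP[_ vx].
  have xv : adj G x v by rewrite adj_sym.
  rewrite Ex_sum; apply: ler_sum => j _; have jN := leq_trans (ltn_ord j) iN.
  rewrite /T (@Ex_twigs k v p x) //.
  - rewrite (@Ex_child_point k v x) //; last first.
      by move=> w w' ww'; rewrite (visits_depends _ ww').
    rewrite (eq_bigr (fun=> sv k j)); last first.
      by move=> y; rewrite !inE => /and3P[_ _ vy]; apply: Ex_later_or_dead => //; exact: ltnW.
    rewrite prodr_const.
    have -> : #|children G v p :\ x| = b.-1.
      by move: card_ch; rewrite (cardsD1 x) xc => <-.
    have V0 : 0 <= E (fun w => (visits w k x v j)%:R).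
      by rewrite -(@Ex_cst R {set 'I_n} N N0 0); apply: ler_Ex => w; rewrite ler0n.
    have s0 := @surv_ge0 R N b N0 k j (ltnW jN).
    have P0 : 0 <= pr by exact: p_ge0.
    apply: ler_pM; [exact: mulr_ge0 | exact: exprn_ge0 | |].
      by apply: ler_wpM2l => //; exact: IH.
    rewrite lerXn2r ?nnegrE ?env_ge0 //; apply: surv_env => //; exact: ltnW.
  - move=> w w' ww'; rewrite (rk_depends ww').
    rewrite (@visits_depends k x v j w w') // => e eb.
    by apply: ww'; rewrite inE eb orbT.
  - by move=> y w w' ww'; rewrite (rk_depends ww') (cstatus_depends ww').
rewrite sumr_const card_ch -[_ *+ b]mulr_natl mulr_sumr; apply: ler_sum => j _.
rewrite -[leRHS]/(hazard R N b j * vbound R N b k j) /hazard.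
by rewrite le_eqVlt; apply/orP; left; apply/eqP; ring.
Qed.

End Local.

(** * The probing strategy *)

Section Strategy.
Local Open Scope nat_scope.
Variables (n N : nat) (G : graph n).
Local Notation Om := {ffun {set 'I_n} -> 'I_N}.
Implicit Types (w : Om) (u v x y p : 'I_n) (i j k : nat).

Fixpoint trunc L (t : probing n) : probing n :=
  match t, L with
  | Answer a, _ => Answer n a
  | Probe _ _, 0 => Answer n false
  | Probe v f, L'.+1 => Probe v (fun S => trunc L' (f S))
  end.

Lemma answer_trunc L t :
  answer G (trunc L t) = answer G t && (num_probes G t <= L).
Proof.
elim: L t => [|L IH] [a|v f] //=; rewrite ?andbT ?andbF //.
Qed.

Lemma num_probes_trunc L t : num_probes G (trunc L t) <= L.
Proof. by elim: L t => [|L IH] [a|v f] //=; rewrite ltnS. Qed.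

(** [l] lists the children by increasing rank. A dead child is skipped and the first other child
    settles the answer; [onfree] checks whether a free child comes strictly before the threshold and
    without ties. *)
Fixpoint scan (f : 'I_n -> (option bool -> probing n) -> probing n)
    (onfree : 'I_n -> option bool) (c : option bool -> probing n) (l : seq 'I_n) :=
  if l is x :: l' then
    f x (fun r => match r with
                  | Some false => scan f onfree c l'
                  | Some true => c (onfree x)
                  | None => c None
                  end)
  else c (Some true).

(** Continuation-passing style chains nested searches into one probing tree; the graph enters only
    through the replies [S]. *)
Fixpoint ask w k v p i (c : option bool -> probing n) : probing n :=
  if k is k'.+1 then
    Probe v (fun S =>
      scan (fun x => ask w k' x v (rk w v x))
        (fun x => if (rk w v x < i) && [forall y in S :\ p :\ x, rk w v y != rk w v x]
                  then Some false else None)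
        c (sort (relpre (rk w v) leq) [seq x <- enum (S :\ p) | rk w v x < i.+1]))
  else c None.

(** Justifies the early stop: later children cannot change the verdict, except by a tie with [x],
    which is visible in the ranks alone. *)
Lemma status_first w k v p i x : x \in children G v p -> rk w v x <= i ->
  cstatus G w k v x != Some false ->
  [forall y in children G v p :\ x,
     (rk w v x <= rk w v y) || (cstatus G w k v y == Some false)] ->
  status G w k.+1 v p i =
    if [&& cstatus G w k v x == Some true, rk w v x < i &
        [forall y in children G v p :\ x, rk w v y != rk w v x]]
    then Some false else None.
Proof.
move=> xc xi nd /forall_inP first_x.
have nf : (status G w k.+1 v p i == Some true) = false.
  rewrite status_freeE; apply/negbTE/negP => /forall_inP/(_ x xc).
  by rewrite ltnNge xi (negbTE nd).
have := status_deadE G w k v p i.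
set c := [&& _, _ & _]; have -> : [exists x0 in children G v p,
    taker (cstatus G w k v) (rk w v) (children G v p) i x0] = c.
  apply/existsP/idP => [[z /andP[zc /and3P[zi sz /forall_inP tz]]]|].
    have [zx|zx] := eqVneq z x.
      subst z; rewrite /c sz zi /=; apply/forall_inP => y /tz.
      by case: ltngtP.
    have := tz x; rewrite !inE eq_sym zx -[(x != p) && _]in_children xc => /(_ isT).
    rewrite (negbTE nd) andbF orbF => zlt.
    have := first_x z; rewrite !inE zx -[(z != p) && _]in_children zc => /(_ isT).
    by rewrite leqNgt zlt /= (eqP sz).
  case/and3P=> sx ri /forall_inP un; exists x; rewrite xc /=; apply/and3P; split=> //.
  apply/forall_inP => y yc; have := un y yc; have := first_x y yc.
  by case: ltngtP => //= _ ->.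
by move: nf; case: (status G w k.+1 v p i) => [[]|] //= _; case: c.
Qed.

Lemma ask_spec w k v p i c :
  answer G (ask w k v p i c) = answer G (c (status G w k v p i)) /\
  num_probes G (ask w k v p i c) <=
    visits G w k v p i + num_probes G (c (status G w k v p i)).
Proof.
elim: k v p i c => [//|k IH] v p i c.
pose A := children G v p.
pose cond x := [forall y in A :\ x,
  (rk w v x <= rk w v y) || (cstatus G w k v y == Some false)].
set st := status G w k.+1 v p i.
set g := fun x => if (rk w v x < i) && [forall y in A :\ x, rk w v y != rk w v x]
                  then Some false else None.
pose f x := ask w k x v (rk w v x).
(* Invariant of the scan: every child of rank at most [i] already removed from the list is certified
   matched. Hence each child entered satisfies [cond] and is paid for by [visits]. *)
have S l : sorted (relpre (rk w v) leq) l -> uniq l ->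
    {subset l <= [pred x | (x \in A) && (rk w v x < i.+1)]} ->
    (forall y, y \in A -> rk w v y <= i -> y \notin l -> cstatus G w k v y = Some false) ->
    answer G (scan f g c l) = answer G (c st) /\
    num_probes G (scan f g c l) <=
      \sum_(x <- l | cond x) visits G w k x v (rk w v x) + num_probes G (c st).
  elim: l => [|x l IHl] /= so ul sub dead.
    have -> : st = Some true.
      apply/eqP; rewrite status_freeE; apply/forall_inP => y yA.
      by case: ltnP => //= yi; apply/eqP; apply: dead.
    by rewrite big_nil.
  have /andP[xA xi] : (x \in A) && (rk w v x < i.+1).
    by apply: (sub x); rewrite inE eqxx.
  have cx : cond x.
    apply/forall_inP => y; rewrite inE => /andP[]; rewrite inE => yx yA.
    case: leqP => //= yr; apply/eqP; apply: dead => //.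
      by rewrite -ltnS; exact: ltn_trans yr xi.
    rewrite inE (negbTE yx) /=; apply/negP => yl.
    have : all (fun z => rk w v x <= rk w v z) l.
      by apply: (order_path_min (leT := relpre (rk w v) leq)) => // a1 a2 a3; exact: leq_trans.
    by move=> /allP/(_ y yl); rewrite leqNgt yr.
  rewrite big_cons cx.
  set c' := (fun r => _).
  have [-> le] := IH x v (rk w v x) c'.
  suff [-> le2] : answer G (c' (cstatus G w k v x)) = answer G (c st) /\
      num_probes G (c' (cstatus G w k v x)) <=
      \sum_(x <- l | cond x) visits G w k x v (rk w v x) + num_probes G (c st).
    by split=> //; apply: leq_trans le _; rewrite -addnA leq_add2l.
  case/andP: ul => xl ul.
  case E : (cstatus G w k v x) => [[]|] /=.
  - have -> : g x = st.
      by rewrite /st (@status_first _ _ _ _ _ x) // ?E.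
    by split=> //; exact: leq_addl.
  - apply: IHl => //.
    + exact: path_sorted so.
    + by move=> z zl; apply: sub; rewrite inE zl orbT.
    + move=> y yA yi yl; have [->//|yx] := eqVneq y x.
      by apply: dead => //; rewrite inE negb_or yx.
  - have -> : st = None by rewrite /st (@status_first _ _ _ _ _ x) // ?E.
    by split=> //; exact: leq_addl.
have [||||a1 a2] := S (sort (relpre (rk w v) leq) [seq x <- enum A | rk w v x < i.+1]).
- by apply: sort_sorted => a1 a2; exact: leq_total.
- by rewrite sort_uniq filter_uniq // enum_uniq.
- by move=> z; rewrite mem_sort mem_filter mem_enum => /andP[h1 h2]; rewrite inE h2.
- move=> y yA yi; rewrite mem_sort mem_filter mem_enum yA ltnS yi //.
split; first exact: a1.
rewrite /= -/A addSn ltnS; apply: leq_trans a2 _; rewrite leq_add2r.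
rewrite (perm_big _ (permEl (perm_sort _ _))) /= big_filter_cond big_enum_cond /=.
by apply: eq_leq; apply: eq_bigl => x; rewrite andbA.
Qed.

(** The algorithm is not told the degree; the first probe reads it off as [#|S|] in order to turn
    the stopping time into a rank threshold. *)
Definition query w k (thr : nat -> nat) (e : {set 'I_n}) : probing n :=
  match enum e with
  | [:: u; v] => Probe u (fun S =>
      if w e < thr #|S| then
        ask w k u v (w e) (fun r =>
          if r == Some true then ask w k v u (w e) (fun r' => Answer n (r' == Some true))
          else Answer n false)
      else Answer n false)
  | _ => Answer n false
  end.

Definition accept w k T u v :=
  [&& rk w u v < T, status G w k u v (rk w u v) == Some true &
      status G w k v u (rk w u v) == Some true].

Lemma acceptC w k T u v : accept w k T u v = accept w k T v u.
Proof. by rewrite /accept (rkC w v u) [X in _ && X]andbC. Qed.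

Lemma edgeP (e : {set 'I_n}) : e \in edges G ->
  exists u v, [/\ adj G u v, e = [set u; v] & enum e = [:: u; v]].
Proof.
rewrite inE => /existsP[a /existsP[c /andP[ac /eqP E]]].
have ne : a != c by apply/eqP => h; move: ac; rewrite h adj_irrefl.
have sz : size (enum e) = 2 by rewrite -cardE E cards2 ne.
have un := enum_uniq e; have me := mem_enum e.
case: (enum e) sz un me => [|u [|v [|]]] // _ un me.
have Ee : e = [set u; v].
  by apply/setP => z; rewrite !inE -[z \in e]me !inE.
exists u, v; split=> //.
have ua : u \in [set a; c] by rewrite -E Ee !inE eqxx.
have va : v \in [set a; c] by rewrite -E Ee !inE eqxx orbT.
have uv : u != v by move: un; rewrite /= inE andbT.
move: ua va; rewrite !inE => /orP[]/eqP Eu /orP[]/eqP Ev; subst u v.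
- by rewrite eqxx in uv.
- exact: ac.
- by rewrite adj_sym.
- by rewrite eqxx in uv.
Qed.

Lemma query_spec w k thr d e u v : regular G d -> e = [set u; v] -> enum e = [:: u; v] ->
  answer G (query w k thr e) = accept w k (thr d) u v /\
  num_probes G (query w k thr e) <=
    ((rk w u v < thr d) *
      (visits G w k u v (rk w u v) + visits G w k v u (rk w u v))).+1.
Proof.
move=> reg Ee En; split.
  rewrite /query En /= reg Ee -/(rk w u v) /accept; case: ltnP => //= _.
  set c := (fun r => _); have [-> _] := ask_spec w k u v (rk w u v) c.
  rewrite /c; case: eqP => //= _.
  by have [-> _] := ask_spec w k v u (rk w u v) (fun r' => Answer n (r' == Some true)).
rewrite /query En /= reg Ee -/(rk w u v) ltnS; case: ltnP => //= _; rewrite mul1n.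
set c := (fun r => _); have [_ le] := ask_spec w k u v (rk w u v) c.
apply: leq_trans le _; rewrite leq_add2l /c; case: eqP => //= _.
have [_ le] := ask_spec w k v u (rk w u v) (fun r' => Answer n (r' == Some true)).
by apply: leq_trans le _; rewrite addn0.
Qed.

(** Of two accepted edges at [v], the later one needs the other end of the earlier one to be
    certified matched, while acceptance of the earlier one certifies that end as free. *)
Lemma accept_unique w k T v u x : adj G v u -> adj G v x ->
  accept w k T v u -> accept w k T v x -> u = x.
Proof.
wlog le : u x / rk w v x <= rk w v u.
  move=> H vu vx au ax; case: (leqP (rk w v x) (rk w v u)) => [|/ltnW] le.
    exact: H.
  by apply/esym; apply: H.
move=> vu vx /and3P[_ su _] /and3P[_ _ sx]; apply/eqP; apply: contraT => ux.
case: k su sx => // k su sx; move: su; rewrite status_freeE => /forall_inP/(_ x).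
rewrite in_children eq_sym ux vx => /(_ isT); rewrite ltnNge le /= => /eqP d.
by case: (@free_dead n N G w k.+1 k x v (rk w v x)); split => //; exact/eqP.
Qed.

Lemma query_matching w k thr L d : regular G d ->
  is_matching G [set e in edges G | answer G (trunc L (query w k thr e))].
Proof.
move=> reg; apply/andP; split.
  by apply/fintype.subsetP => e; rewrite inE => /andP[].
apply/finset.trivIsetP => e f; rewrite ![_ \in [set _ in _ | _]]inE.
move=> /andP[eE ae] /andP[fE af] ef.
rewrite -finset.setI_eq0; apply: contraT => /set0Pn[z]; rewrite inE => /andP[ze zf].
have H g : g \in edges G -> answer G (trunc L (query w k thr g)) -> z \in g ->
    exists y, [/\ adj G z y, g = [set z; y] & accept w k (thr d) z y].
  move=> gE; rewrite answer_trunc => /andP[ag _] zg.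
  have [u [v [uv Eg En]]] := edgeP gE; have [Ea _] := query_spec w k thr reg Eg En.
  rewrite Ea in ag; move: zg; rewrite Eg !inE => /orP[]/eqP->.
    by exists v.
  by exists u; rewrite adj_sym finset.setUC acceptC.
have [y [zy Ey ay]] := H e eE ae ze; have [x [zx Ex ax]] := H f fE af zf.
by rewrite Ey Ex (accept_unique zy zx ay ax) eqxx in ef.
Qed.

End Strategy.

(** * Expected size of the matching *)

Lemma card_edge n (G : graph n) e : e \in edges G -> #|e| = 2.
Proof.
case/edgeP => u [v [uv -> _]]; rewrite cards2.
by case: eqP => // E; rewrite E adj_irrefl in uv.
Qed.

Lemma card_edges_regular n (G : graph n) d : regular G d -> (#|edges G| * 2 = n * d)%N.
Proof.
move=> reg.
rewrite -sum_nat_const (eq_bigr (fun e : {set 'I_n} => \sum_(v in e) 1)%N); last first.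
  by move=> e /card_edge; rewrite sum1_card => ->.
rewrite (exchange_big_dep predT) //=.
rewrite (eq_bigr (fun=> d)) ?sum_nat_const ?card_ord // => v _.
rewrite sum1dep_card -(reg v).
have inj : {in neighbors G v &, injective (fun w => [set v; w])}.
  move=> x y; rewrite !inE => vx vy /setP/(_ x); rewrite !inE eqxx orbT.
  case/esym/orP => /eqP // E; by rewrite E adj_irrefl in vx.
rewrite -(card_in_imset inj); congr #|pred_of_set _|; apply/setP => e.
rewrite [in LHS]inE; apply/andP/imsetP => [[/edgeP[x [y [xy -> _]]]]|].
  rewrite !inE => /orP[]/eqP->; first by exists y; rewrite ?inE.
  by exists x; rewrite ?inE ?[adj G y x]adj_sym // finset.setUC.
case=> y; rewrite inE => vy ->; split; last by rewrite !inE eqxx.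
by rewrite inE; apply/existsP; exists v; apply/existsP; exists y; rewrite vy eqxx.
Qed.

Lemma max_matching_le n (G : graph n) : (max_matching_size G * 2 <= n)%N.
Proof.
rewrite muln2 -geq_half_double.
apply/bigmax_leqP => M /andP[/fintype.subsetP ME tM].
rewrite geq_half_double -muln2 -sum_nat_const.
rewrite (eq_bigr (fun e : {set 'I_n} => #|e|)); last by move=> e /ME/card_edge.
by rewrite (eqP tM) -[leqRHS]card_ord max_card.
Qed.

Section EdgeProbability.
Variables (R : realType) (n N b k T : nat) (G : graph n).
Hypothesis N0 : (0 < N)%N.
Hypothesis Greg : regular G b.+1.
Hypothesis k0 : (0 < k)%N.
Hypothesis gG : big_girth G k.
Hypothesis TN : (T <= N)%N.
Local Notation E := (@Ex R {set 'I_n} N).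
Local Notation p := (N%:R^-1 : R).

Lemma edge_notin_branches u v : adj G u v ->
  [set u; v] \notin branch G k u v :|: branch G k v u.
Proof.
have H c : is_cycle G c -> (k.+1 < size c)%N.
  by move/gG; apply: leq_ltn_trans; lia.
move=> uv; rewrite inE negb_or edge_notin_branch //=.
by rewrite finset.setUC edge_notin_branch // adj_sym.
Qed.

Lemma Ex_accept u v : adj G u v ->
  E (fun w => (accept G w k T u v)%:R) = p * \sum_(i < T) pfree R N b k i ^+ 2.
Proof.
move=> uv; have vu : adj G v u by rewrite adj_sym.
pose F j (w : {ffun {set 'I_n} -> 'I_N}) : R := (j < T)%:R *
  ((status G w k u v j == Some true)%:R * (status G w k v u j == Some true)%:R).
have -> : E (fun w => (accept G w k T u v)%:R) = E (fun w => F (w [set u; v]) w).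
  by apply: eq_Ex => w; rewrite /accept /F -!mulnb !natrM.
rewrite (Ex_rank N0 (edge_notin_branches uv)); last first.
  move=> j w w' ww'; rewrite /F.
  rewrite (@status_depends _ _ G k u v j w w'); last first.
    by move=> e eb; apply: ww'; rewrite inE eb.
  rewrite (@status_depends _ _ G k v u j w w') // => e eb.
  by apply: ww'; rewrite inE eb orbT.
congr (_ * _); rewrite (big_ord_widen N (fun i => pfree R N b k i ^+ 2) TN).
rewrite [RHS]big_mkcond /=; apply: eq_bigr => j _.
rewrite /F ExZ; case: (j < T)%N; rewrite ?mul0r // mul1r.
rewrite (Ex_indep N0 (branch_disjoint gG uv)).
- have L := status_law R N0 Greg gG.
  by have [-> _] := L u v j uv (ltn_ord j); have [-> _] := L v u j vu (ltn_ord j).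
- by move=> w w' ww'; rewrite (status_depends _ ww').
- by move=> w w' ww'; rewrite (status_depends _ ww').
Qed.

Hypothesis b0 : (0 < b)%N.
Hypothesis N1 : (1 < N)%N.

(** No search is run for ranks from [T] on. The resulting factor [T / N = t / d] cancels the [d]
    edges at a vertex, so the truncation loss does not grow with the degree. *)
Lemma Ex_visits2 u v (V : R) : adj G u v ->
  (forall i, (i < T)%N -> vbound R N b k i <= V) ->
  E (fun w => ((rk w u v < T)%N * (visits G w k u v (rk w u v) +
     visits G w k v u (rk w u v)))%N%:R) <= 2 * V * (T%:R * p).
Proof.
move=> uv HV; have vu : adj G v u by rewrite adj_sym.
pose F j (w : {ffun {set 'I_n} -> 'I_N}) : R := (j < T)%:R *
  ((visits G w k u v j)%:R + (visits G w k v u j)%:R).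
have -> : E (fun w => ((rk w u v < T)%N * (visits G w k u v (rk w u v) +
     visits G w k v u (rk w u v)))%N%:R) = E (fun w => F (w [set u; v]) w).
  by apply: eq_Ex => w; rewrite /F natrM natrD.
rewrite (Ex_rank N0 (edge_notin_branches uv)); last first.
  move=> j w w' ww'; rewrite /F.
  rewrite (@visits_depends _ _ G k u v j w w'); last first.
    by move=> e eb; apply: ww'; rewrite inE eb.
  rewrite (@visits_depends _ _ G k v u j w w') // => e eb.
  by apply: ww'; rewrite inE eb orbT.
rewrite [leRHS]mulrA [leRHS]mulrC; apply: ler_wpM2l; first exact: p_ge0.
have -> : 2 * V * T%:R = \sum_(j < N) (if (j < T)%N then 2 * V else 0).
  rewrite -big_mkcond /= -(big_ord_widen N (fun=> 2 * V) TN) sumr_const card_ord.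
  by rewrite mulr_natr.
apply: ler_sum => j _; rewrite /F ExZ; case: ltnP => jT; rewrite ?mul0r // mul1r ExD.
have h1 := @Ex_visits _ _ G R b N0 Greg b0 N1 k u v j gG uv (ltn_ord j).
have h2 := @Ex_visits _ _ G R b N0 Greg b0 N1 k v u j gG vu (ltn_ord j).
have := HV j jT; lra.
Qed.

Lemma Ex_query_ge (thr : nat -> nat) (L : nat) (V : R) e : e \in edges G ->
  thr b.+1 = T -> (0 < L)%N ->
  (forall i, (i < T)%N -> vbound R N b k i <= V) ->
  p * \sum_(i < T) pfree R N b k i ^+ 2 - 2 * V * (T%:R * p) / L%:R <=
  E (fun w => (answer G (trunc L (query w k thr e)))%:R).
Proof.
move=> eE thrT L0 HV; have [u [v [uv Ee En]]] := edgeP eE.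
have L0' : 0 < L%:R :> R by rewrite ltr0n.
pose X (w : {ffun {set 'I_n} -> 'I_N}) : R := ((rk w u v < T)%N *
  (visits G w k u v (rk w u v) + visits G w k v u (rk w u v)))%N%:R.
have H1 := Ex_accept uv; have H2 := Ex_visits2 uv HV; rewrite -/X in H2.
(* Markov's inequality pointwise: at most [X + 1] probes are made, so a truncated search has
   [X >= L]. *)
apply: (@le_trans _ _ (E (fun w => (accept G w k T u v)%:R - L%:R^-1 * X w))).
  rewrite ExB ExZ H1 lerD2l lerN2 mulrC ler_wpM2r ?invr_ge0 ?ler0n //.
apply: ler_Ex => w; rewrite answer_trunc.
have [Ea Hn] := query_spec w k thr Greg Ee En; rewrite Ea thrT /X.
rewrite thrT in Hn.
set Y := (_ * _)%N in Hn *.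
case: (accept _ _ _ _ _ _) => /=; last first.
  by rewrite sub0r oppr_le0 mulr_ge0 ?invr_ge0 ?ler0n.
case: leqP => /= hn; first by rewrite gerBl mulr_ge0 ?invr_ge0 ?ler0n.
have : (L <= Y)%N by rewrite -ltnS; exact: leq_trans hn Hn.
by rewrite -(ler_nat R) subr_le0 ler_pdivlMl // mulr1.
Qed.

End EdgeProbability.

(** * The algorithm, and reduction to the probability of one edge *)

Section GreedyLca.
Variables (R : realType) (Nf : nat -> nat) (k : nat) (thr : nat -> nat -> nat) (L : nat).
Hypothesis Nf0 : forall n, (0 < Nf n)%N.

Definition rank_table n : finType := {ffun {set 'I_n} -> 'I_(Nf n)}.
Definition seed_unif n (_ : rank_table n) : R := #|{: rank_table n}|%:R^-1.

Lemma seed_unif_ge0 n (r : rank_table n) : 0 <= seed_unif r.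
Proof. by rewrite invr_ge0 ler0n. Qed.

Lemma seed_unif_sum1 n : \sum_(r : rank_table n) seed_unif r = 1.
Proof.
rewrite /seed_unif sumr_const -[LHS]mulr_natl mulfV //.
by rewrite gt_eqF // (card_ranks_gt0 R {set 'I_n} (Nf0 n)).
Qed.

Definition greedy_lca : lca R :=
  @Lca R rank_table seed_unif seed_unif_ge0 seed_unif_sum1
    (fun n w e => trunc L (query w k (thr n) e)).

Lemma greedy_lca_matching n (G : graph n) d (r : seed greedy_lca n) :
  regular G d -> is_matching G (lca_edges G r).
Proof. exact: query_matching. Qed.

Lemma greedy_lca_probes n (G : graph n) (r : seed greedy_lca n) e :
  (num_probes G (strategy r e) <= L)%N.
Proof. exact: num_probes_trunc. Qed.

(** A regular graph has [n d / 2] edges and a matching has at most [n / 2], so it suffices that a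
    vertex is matched with probability at least [c]. *)
Lemma greedy_lca_size n (G : graph n) d (c q : R) : regular G d -> 0 <= c -> c <= d%:R * q ->
  (forall e, e \in edges G -> q <= @Ex R {set 'I_n} (Nf n)
     (fun w => (answer G (trunc L (query w k (thr n) e)))%:R)) ->
  c * (max_matching_size G)%:R <= lca_expected_size greedy_lca G.
Proof.
move=> reg c0 cq Hq.
apply: (@le_trans _ _ (#|edges G|%:R * q)).
  have E : #|edges G|%:R * 2 = n%:R * d%:R :> R by rewrite -!natrM (card_edges_regular reg).
  have M : (max_matching_size G)%:R * 2 <= n%:R :> R.
    by rewrite -natrM ler_nat max_matching_le.
  have M0 : 0 <= (max_matching_size G)%:R :> R by rewrite ler0n.
  have h1 : c * (max_matching_size G)%:R * 2 <= c * n%:R by rewrite -mulrA ler_wpM2l.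
  have h2 : c * n%:R <= d%:R * q * n%:R by rewrite ler_wpM2r ?ler0n.
  have -> : #|edges G|%:R * q = (#|edges G|%:R * 2) * q / 2 by field.
  rewrite E ler_pdivlMr //; apply: le_trans h1 (le_trans h2 _).
  by rewrite le_eqVlt; apply/orP; left; apply/eqP; ring.
rewrite /lca_expected_size.
rewrite (eq_bigr (fun w => #|{: rank_table n}|%:R^-1 *
   \sum_(e in edges G) (answer G (trunc L (query w k (thr n) e)))%:R)); last first.
  move=> w _; congr (_ * _); rewrite -natr_sum; congr (_%:R).
  by rewrite -big_mkcondr sum1dep_card.
rewrite -mulr_sumr -/(Ex _) Ex_sum mulr_natl -sumr_const; exact: ler_sum.
Qed.

End GreedyLca.

(** * Matched fraction with [M] ranks per unit of time *)

Section Density.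
Variables (R : realType) (b M t K : nat).
Hypothesis b1 : (1 < b)%N.
Hypothesis M0 : (0 < M)%N.
Hypothesis tb : (t <= b.+1)%N.
Local Notation N := (b.+1 * M)%N.
Local Notation T := (t * M)%N.
Local Notation p := (N%:R^-1 : R).
Local Notation tau := (@cumh R N b T).

Let b0 : (0 < b)%N := ltnW b1.
Lemma rank_count_gt1 : (1 < N)%N.
Proof using b1 M0. by apply: leq_trans (leq_pmulr _ M0); rewrite ltnS ltnW. Qed.
Lemma time_le_rank_count : (T <= N)%N.
Proof. by rewrite leq_mul2r tb orbT. Qed.
Let N1 := rank_count_gt1.
Let N0 : (0 < N)%N := ltnW N1.

Lemma time_ratio : T%:R * p = t%:R / b.+1%:R :> R.
Proof.
by rewrite !natrM; field; rewrite nat1r !pnatr_eq0 -!lt0n M0.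
Qed.

(** Combines [success_ge] and [env_pow_le]. Integrating [punk_le] once more against the hazard
    raises the exponent to [K.+1]; [3 / 2] bounds [(b+1)/b] for [b >= 2]. *)
Lemma greedy_density :
  1 - (1 + t%:R)^-1 - 3 / 2 * (tau ^+ K.+1 / (K.+1)`!%:R) - 3 * b.+1%:R ^+ K.+3 * p
  <= b.+1%:R * (p * \sum_(i < T) pfree R N b K.+1 i ^+ 2).
Proof.
have S := @success_ge R N b N0 b0 N1 K T time_le_rank_count.
have Ht : env R N b T ^+ b.+1 <= (1 + t%:R)^-1.
  have := @env_pow_le R N b N0 b0 N1 T.
  by rewrite -mulrA [p * _]mulrC time_ratio mulrCA mulfV ?mulr1 // pnatr_eq0.
have t0 : 0 <= tau by exact: cumh_ge0.
have tb' : tau <= b%:R by apply: cumh_le => //; exact: time_le_rank_count.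
have P0 : 0 <= p by exact: p_ge0.
have b2 : 2 <= b%:R :> R by rewrite ler_nat.
have d1 : b.+1%:R = b%:R + 1 :> R by rewrite natr1.
set kap : R := b%:R ^+ 2 * p.
have K0 : 0 <= kap by rewrite mulr_ge0 ?exprn_ge0 ?ler0n.
have U : \sum_(i < T) hazard R N b i * punk R N b K i <=
    tau ^+ K.+1 / (K.+1)`!%:R + kap * b%:R * b.+1%:R ^+ K.
  apply: (@le_trans _ _ (\sum_(i < T) (hazard R N b i * cumh R N b i ^+ K) / K`!%:R +
      \sum_(i < T) hazard R N b i * (kap * b.+1%:R ^+ K))).
    rewrite -big_split /=; apply: ler_sum => i _.
    have iN := leq_trans (ltn_ord i) time_le_rank_count.
    rewrite -mulrA -mulrDr ler_wpM2l ?hazard_ge0 //.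
    apply: (@le_trans _ _ _ _ _ (@punk_le R N b N0 b0 N1 K i iN)).
    rewrite lerD2l ler_wpM2l // lerXn2r ?nnegrE ?ler0n ?addr_ge0 ?ler01 ?cumh_ge0 //.
    by rewrite d1 addrC lerD2r cumh_le // ltnW.
  rewrite -!mulr_suml; apply: lerD.
    rewrite factS natrM invfM mulrA ler_wpM2r ?invr_ge0 ?ler0n //.
    exact: sum_hazard_cumhX.
  rewrite -/(cumh R N b T) [leRHS](_ : _ = b%:R * (kap * b.+1%:R ^+ K)); last by ring.
  by rewrite ler_wpM2r // mulr_ge0 ?exprn_ge0 ?ler0n.
have D : b.+1%:R / b%:R <= 3 / 2 :> R.
  by rewrite d1 ler_pdivrMr; lra.
have D0 : 0 <= b.+1%:R / b%:R :> R by rewrite divr_ge0 ?ler0n.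
have H0 : 0 <= \sum_(i < T) hazard R N b i * punk R N b K i.
  apply: sumr_ge0 => i _; have iN := leq_trans (ltn_ord i) time_le_rank_count.
  by rewrite mulr_ge0 ?hazard_ge0 //; have [] := @punk_bounds R N b N0 K i iN.
have Q := ler_pM D0 H0 D U.
have W : 3 / 2 * (kap * b%:R * b.+1%:R ^+ K) + b.+1%:R * b%:R * p * (T%:R * p) <=
   3 * b.+1%:R ^+ K.+3 * p.
  have h1 : kap * b%:R * b.+1%:R ^+ K <= b.+1%:R ^+ K.+3 * p.
    have -> : kap * b%:R * b.+1%:R ^+ K = b%:R ^+ 3 * b.+1%:R ^+ K * p by rewrite /kap; ring.
    rewrite -[K.+3]/(3 + K)%N exprD ler_wpM2r // ler_wpM2r ?exprn_ge0 ?ler0n //.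
    by rewrite lerXn2r ?nnegrE ?ler0n ?ler_nat.
  have h2 : b.+1%:R * b%:R * p * (T%:R * p) <= b.+1%:R ^+ K.+3 * p.
    apply: (@le_trans _ _ (b.+1%:R * b%:R * p)).
      by rewrite ler_piMr ?mulr_ge0 ?ler0n // mulp_le1 // time_le_rank_count.
    rewrite ler_wpM2r // -[K.+3]/(2 + K.+1)%N exprD.
    apply: (@le_trans _ _ (b.+1%:R ^+ 2)).
      by rewrite expr2 ler_wpM2l ?ler0n // ler_nat.
    by rewrite ler_peMr ?exprn_ge0 ?ler0n // exprn_ege1 // ler1n.
  have h3 : 0 <= b.+1%:R ^+ K.+3 * p by rewrite mulr_ge0 ?exprn_ge0 ?ler0n.
  rewrite -[leRHS]mulrA; set C := b.+1%:R ^+ K.+3 * p in h1 h2 h3 *.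
  set A := kap * _ * _ in h1 *; set B := _ * (T%:R * p) in h2 *; lra.
rewrite mulrDr in Q; rewrite [leRHS]mulrA.
set A1 := tau ^+ _ / _ in Q *; set A2 := kap * _ * _ in Q W.
set A3 := _ * (T%:R * p) in S W; set A4 := 3 * _ * p in W *.
set A5 := _ * (\sum_(i < T) pfree _ _ _ _ _ ^+ 2) in S *.
set A6 := _ / _ * (\sum_(i < T) _) in S Q.
lra.
Qed.

Lemma expR_tau_le (c : R) : b%:R * p < 1 -> (1 - b%:R * p)^-1 <= c ->
  expR tau <= c ^+ 2 * ((1 + t%:R / b.+1%:R) * (1 + b.-1%:R * (t%:R / b.+1%:R))).
Proof.
move=> bp cc; have := @expR_cumh_le R N b N0 b0 N1 T b1 bp.
rewrite mulrA time_ratio; set s : R := t%:R / b.+1%:R.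
have s0 : 0 <= s by rewrite divr_ge0 ?ler0n.
set c0 := (1 - _)^-1 in cc *.
have P0 : 0 <= p by exact: p_ge0.
have bp0 : 0 <= b%:R * p by rewrite mulr_ge0 ?ler0n.
have c1 : 1 <= c0 by rewrite /c0 -[leLHS]invr1 lef_pV2 ?posrE ?ltr01 ?subr_gt0 // gerBl.
have b0' : 0 <= b.-1%:R :> R by rewrite ler0n.
have h1 : 1 + s * c0 <= c * (1 + s).
  rewrite mulrDr mulr1; apply: lerD; first by lra.
  by rewrite mulrC ler_wpM2r.
have h2 : 1 + b.-1%:R * (s * c0) <= c * (1 + b.-1%:R * s).
  rewrite mulrDr mulr1; apply: lerD; first by lra.
  by rewrite mulrA mulrC ler_wpM2r // mulr_ge0.
move=> h; apply: le_trans h _.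
rewrite [leRHS](_ : _ = (c * (1 + s)) * (c * (1 + b.-1%:R * s))); last by ring.
have c00 : 0 <= c0 by lra.
by apply: ler_pM => //; rewrite addr_ge0 ?mulr_ge0.
Qed.

Lemma vbound_tau i k : b%:R * p <= 2^-1 -> (i < T)%N ->
  vbound R N b k i <= expR tau ^+ 2.
Proof.
move=> bp iT; apply: (@le_trans _ _ _ _ _ (@vbound_le R N b N0 b0 N1 k i bp)).
rewrite -expRM_natl ler_expR ler_wpM2l // cumh_mono //.
Qed.

End Density.

(** * Choice of the number of ranks, and correctness for admissible parameters *)

Lemma girth_big (R : realType) n (G : graph n) (a : R) (k : nat) :
  (a%:E <= girth R G)%E -> k.*2%:R < a -> big_girth G k.
Proof.
move=> ga ka c cc; rewrite -(ltr_nat R); apply: lt_le_trans ka _.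
rewrite -lee_fin; apply: le_trans ga _; apply: ereal_inf_lbound.
by exists c.
Qed.

Lemma regular_lt n (G : graph n) d : regular G d -> (0 < n)%N -> (d < n)%N.
Proof.
case: n G => // n G reg _; rewrite -(reg ord0) -[ltnRHS]card_ord.
rewrite -[ltnRHS]cardsT; apply: proper_card; rewrite finset.properT.
by apply/eqP => /setP/(_ ord0); rewrite !inE adj_irrefl.
Qed.

Lemma lca_expected_ge0 (R : realType) (A : lca R) n (G : graph n) :
  0 <= lca_expected_size A G.
Proof. by apply: sumr_ge0 => r _; rewrite mulr_ge0 ?seed_prob_ge0 ?ler0n. Qed.

Lemma max_matching0 (G : graph 0) : max_matching_size G = 0.
Proof. by have := max_matching_le G; lia. Qed.

(* The factorial makes the number of ranks divisible by every possible degree. *)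
Definition rank_size m k n := (n`! * (100 * m ^ 2 * n.+1 ^ k.+2))%N.

Lemma rank_size_gt0 m k n : (0 < m)%N -> (0 < rank_size m k n)%N.
Proof. by move=> m0; rewrite muln_gt0 fact_gt0 muln_gt0 muln_gt0 !expn_gt0 m0. Qed.

Lemma rank_size_ge m k n d : (d <= n)%N -> (100 * m ^ 2 * d ^ k.+2 <= rank_size m k n)%N.
Proof.
move=> dn; apply: (@leq_trans (100 * m ^ 2 * n.+1 ^ k.+2)).
  by rewrite leq_mul2l leq_exp2r ?(leqW dn) ?orbT.
by rewrite leq_pmull ?fact_gt0.
Qed.

Lemma rank_size_div m k n d : (0 < d)%N -> (d <= n)%N ->
  rank_size m k n = (d * (rank_size m k n %/ d))%N.
Proof.
move=> d0 dn; rewrite mulnC divnK // dvdn_mulr //.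
by apply: dvdn_fact; rewrite d0.
Qed.

(** The [900] is [100 * 9], from [9 b <= (b+1)^3] for [b >= 2]. *)
Lemma rank_size_error (R : realType) m k b N : (0 < m)%N -> (0 < k)%N -> (1 < b)%N -> (0 < N)%N ->
  (100 * m ^ 2 * b.+1 ^ k.+2 <= N)%N ->
  b%:R * (N%:R^-1 : R) <= 900^-1 /\
  3 * b.+1%:R ^+ k.+2 * N%:R^-1 <= 3 / 100 / m%:R ^+ 2 :> R.
Proof.
move=> m0 k0 b1 N0 le; have N0R : 0 < N%:R :> R by rewrite ltr0n.
split.
  rewrite ler_pdivrMr // mulrC ler_pdivlMr ?ltr0n // -natrM ler_nat.
  apply: leq_trans le.
  have h1 : (1 <= m ^ 2)%N by rewrite expn_gt0 m0.
  have h2 : (9 * b <= b.+1 ^ k.+2)%N.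
    apply: (@leq_trans (b.+1 ^ 3)); last by rewrite leq_pexp2l.
    rewrite !expnS expn0; nia.
  have := leq_mul h1 h2; move: (m ^ 2)%N (b.+1 ^ k.+2)%N => A D; lia.
have m20 : 0 < m%:R ^+ 2 :> R by rewrite exprn_gt0 // ltr0n.
move: le; rewrite -(ler_nat R) natrM natrM natrX natrX.
move: (m%:R ^+ 2) m20 (b.+1%:R ^+ k.+2) => A A0 D.
rewrite -(ler_pM2r (_ : 0 < N%:R^-1 :> R)) ?invr_gt0 // mulfV ?gt_eqF // => h.
rewrite ler_pdivlMr // -(ler_pM2l (_ : 0 < 100 :> R)) //.
by move: h; set P := N%:R^-1; lra.
Qed.

(* [x] stands for the cumulated hazard at the final time [t]; the four terms bound the
   unmatched vertices, the undecided searches, the ties and the truncated searches. *)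
Definition admissible (R : realType) (eps : R) m k tA :=
  forall d : nat, (2 < d)%N -> 1 / eps <= d%:R ->
    let t : R := (minn d tA)%:R in
    forall x : R, 0 <= x ->
    expR x <= 201 / 200 * ((1 + t / d%:R) * (1 + (d%:R - 2) * (t / d%:R))) ->
    (1 + t)^-1 + 3 / 2 * (x ^+ k / k`!%:R) + 3 / 100 / m%:R ^+ 2
      + 2 * expR x ^+ 2 * t / (200 * m%:R ^+ 7) <= eps.

Lemma greedy_lca_correct (R : realType) (eps : R) (m k tA : nat) :
  0 < eps -> eps < 2^-1 -> (1 < m)%N -> m%:R * eps <= 1 -> (0 < k)%N ->
  k.*2%:R < 1 / eps ^+ 3 ->
  admissible eps m k tA ->
  exists A : lca R,
  forall (n : nat) (G : graph n) (d : nat),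
    regular G d ->
    1 / eps <= d%:R ->
    ((1 / eps ^+ 3)%:E <= girth R G)%E ->
    [/\ forall r : seed A n, is_matching G (lca_edges G r),
        (1 - eps) * (max_matching_size G)%:R <= lca_expected_size A G
      & forall (r : seed A n) (e : {set 'I_n}), e \in edges G ->
          (num_probes G (strategy r e))%:R <= 200 / eps ^+ 7].
Proof.
move=> eps0 eps1 m1 meps k0 kg num.
have m0 : (0 < m)%N by exact: ltnW.
pose Nf := rank_size m k; have Nf0 n := rank_size_gt0 k n m0.
(* One unit of time is [Nf n / d] ranks; at time [d] all ranks are used up, hence the minimum. *)
pose thr n d := (minn d tA * (Nf n %/ d))%N.
pose L := (200 * m ^ 7)%N.
exists (greedy_lca R k thr L Nf0) => n G d reg epsd gG; split.
- by move=> r; apply: greedy_lca_matching reg.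
- case: (posnP n) => [n0|n0].
    by subst n; rewrite max_matching0 mulr0 lca_expected_ge0.
  have dn : (d <= n)%N by apply: ltnW; apply: regular_lt reg n0.
  have d2 : (2 < d)%N.
    rewrite -(ltr_nat R); apply: lt_le_trans epsd.
    by rewrite div1r -[ltLHS]invrK ltf_pV2 ?posrE.
  have {num} := num d d2 epsd.
  case: d reg epsd dn d2 => // b reg epsd dn d2.
  have bg := girth_big gG kg.
  set t := minn b.+1 tA => num.
  set M := (Nf n %/ b.+1)%N.
  have EN : Nf n = (b.+1 * M)%N by exact: rank_size_div.
  have M0 : (0 < M)%N by move: (Nf0 n); rewrite -/Nf -/(Nf n) EN muln_gt0 => /andP[].
  have tb : (t <= b.+1)%N by exact: geq_minl.
  have b1 : (1 < b)%N by [].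
  have b0 : (0 < b)%N by exact: ltnW.
  set N := (b.+1 * M)%N in EN.
  have N1 : (1 < N)%N by exact: rank_count_gt1.
  have N0 : (0 < N)%N by exact: ltnW.
  set p : R := N%:R^-1.
  set d := b.+1%:R : R.
  have dE : d = b%:R + 1 by rewrite /d natr1.
  have b2 : 2 <= b%:R :> R by rewrite ler_nat.
  have d3 : 3 <= d by rewrite dE; lra.
  have p0 : 0 < p by rewrite invr_gt0 ltr0n.
  have m2 : 2 <= m%:R :> R by rewrite ler_nat.
  have [bp err] : b%:R * p <= 900^-1 /\ 3 * d ^+ k.+2 * p <= 3 / 100 / m%:R ^+ 2.
    by apply: rank_size_error => //; rewrite -EN; exact: rank_size_ge.
  have bp0 : 0 <= b%:R * p by rewrite mulr_ge0 ?ler0n // ltW.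
  have bp1 : b%:R * p < 1 by apply: le_lt_trans bp _; lra.
  (* [900/899 <= 501/500], whose square is below the [201/200] of [admissible]. *)
  have cle : (1 - b%:R * p)^-1 <= 501 / 500.
    rewrite -[leLHS]mul1r ler_pdivrMr ?subr_gt0 //.
    by move: (b%:R * p) bp => y; clear; lra.
  set x := cumh R N b (t * M).
  have x0 : 0 <= x by exact: cumh_ge0.
  have Ex1 := @expR_tau_le R b M t b1 M0 _ bp1 cle.
  have s0 : 0 <= t%:R / d by rewrite divr_ge0 ?ler0n.
  have bpE : b.-1%:R = d - 2 :> R.
    by rewrite /d -(prednK b0) /= -natr1 -natr1; ring.
  have {}num : (1 + t%:R)^-1 + 3 / 2 * (x ^+ k / k`!%:R) + 3 / 100 / m%:R ^+ 2
      + 2 * expR x ^+ 2 * t%:R / (200 * m%:R ^+ 7) <= eps.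
    apply: num => //; apply: (le_trans Ex1); rewrite bpE -/d; apply: ler_wpM2r.
      have d20 : 0 <= d - 2 by move: d3; clear; lra.
      by apply: mulr_ge0; apply: addr_ge0 => //; exact: mulr_ge0.
    by clear; lra.
  have V i : (i < t * M)%N -> vbound R N b k i <= expR x ^+ 2.
    by move=> iT; apply: vbound_tau => //; apply: le_trans bp _; lra.
  have TN : (t * M <= Nf n)%N by rewrite EN; apply: time_le_rank_count.
  pose q : R := (Nf n)%:R^-1 * (\sum_(i < t * M) pfree R (Nf n) b k i ^+ 2) -
    2 * expR x ^+ 2 * ((t * M)%:R * (Nf n)%:R^-1) / L%:R.
  apply: (@greedy_lca_size R Nf k thr L Nf0 n G b.+1 (1 - eps) q) => //; first by lra.
    rewrite /q EN -/p -/d mulrBr.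
    have D := @greedy_density R b M t k.-1 b1 M0 tb.
    rewrite prednK // -/N -/p -/x -/d in D.
    have TE : (t * M)%:R * p = t%:R / d by apply: time_ratio.
    rewrite TE.
    have LE : L%:R = 200 * m%:R ^+ 7 :> R by rewrite /L natrM natrX.
    rewrite LE.
    have -> : d * (2 * expR x ^+ 2 * (t%:R / d) / (200 * m%:R ^+ 7)) =
       2 * expR x ^+ 2 * t%:R / (200 * m%:R ^+ 7).
      have dn0 : d != 0 by rewrite pnatr_eq0.
      by rewrite mulrA; congr (_ * _); move: dn0; move: (d) => y y0; field.
    set A1 := 2 * _ * t%:R / _ in num *; set A2 := x ^+ k / _ in num D.
    set A3 := 3 * _ * p in D err; set A4 := 3 / 100 / _ in num err.
    set A5 := d * _ in D *; set A6 := (1 + t%:R)^-1 in num D.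
    lra.
  move=> e eE; have L0 : (0 < L)%N by rewrite muln_gt0 expn_gt0 m0.
  have N1' : (1 < Nf n)%N by rewrite EN.
  have V' i : (i < t * M)%N -> vbound R (Nf n) b k i <= expR x ^+ 2 by rewrite EN; exact: V.
  exact: Ex_query_ge V'.
- move=> r e _; apply: (@le_trans _ _ L%:R).
    by rewrite ler_nat; exact: greedy_lca_probes.
  rewrite /L natrM ler_wpM2l ?ler0n // natrX -div1r ler_pdivlMr ?exprn_gt0 //.
  by rewrite -exprMn exprn_ile1 // mulr_ge0 ?ler0n // ltW.
Qed.

(** * Numerical estimates *)

Lemma expR_ge_sum (R : realType) (x : R) n : 0 <= x ->
  \sum_(i < n) x ^+ i / i`!%:R <= expR x.
Proof.
move=> x0; rewrite -(big_mkord predT (fun i => x ^+ i / i`!%:R)).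
apply: (nondecreasing_cvgn_le (u_ := series (exp_coeff x))); last exact: is_cvg_series_exp_coeff.
by apply: nondecreasing_series => i _ _; exact: exp_coeff_ge0.
Qed.

(** One term of the series of [exp(2x)]. It makes the undecided probability decay geometrically in
    the depth once [exp x] is polynomial. *)
Lemma expr_fact_le_expR (R : realType) (x : R) k : 0 <= x ->
  x ^+ k / k`!%:R <= expR x ^+ 2 / 2 ^+ k.
Proof.
move=> x0; rewrite -expRM_natl ler_pdivlMr ?exprn_gt0 //.
have x2 : 0 <= 2 * x by rewrite mulr_ge0.
apply: le_trans (expR_ge_sum k.+1 x2); rewrite big_ord_recr /= exprMn.
rewrite -mulrA [_^-1 * _]mulrC mulrA [x ^+ k * _]mulrC lerDr.
by apply: sumr_ge0 => i _; rewrite divr_ge0 ?ler0n ?exprn_ge0.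
Qed.

Lemma exponent_le_t2 (R : realType) (d x : R) : 3 <= d ->
  expR x <= 201 / 200 * ((1 + 2 / d) * (1 + (d - 2) * (2 / d))) ->
  x <= 23 / 20 /\ expR x <= 63 / 20.
Proof.
move=> d3 H.
have z0 : d * d^-1 = 1 by rewrite mulfV // gt_eqF //; lra.
(* With [z = 1/d] the product is [3 + 2z - 8z^2], maximal at [z = 1/8]. *)
have E : (1 + 2 / d) * (1 + (d - 2) * (2 / d)) <= 25 / 8.
  have -> : (1 + 2 / d) * (1 + (d - 2) * (2 / d)) =
    (1 + 2 * d^-1) * (1 + 2 * (d * d^-1) - 4 * d^-1) by ring.
  by rewrite z0; have := sqr_ge0 (d^-1 - 8^-1); rewrite expr2; lra.
have H2 : expR x <= 63 / 20 - 1 / 200 by apply: le_trans H _; lra.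
split; last by lra.
rewrite leNgt; apply/negP => h.
have y0 : 0 <= 23 / 20 :> R by lra.
have := expR_ge_sum 6 y0; rewrite !big_ord_recr big_ord0 /= !exprS expr0.
move: h; rewrite -ltr_expR => h; rewrite /factorial /=; lra.
Qed.

Lemma exponent_le_t3 (R : realType) (d x : R) : 3 <= d ->
  expR x <= 201 / 200 * ((1 + 3 / d) * (1 + (d - 2) * (3 / d))) ->
  x <= 8 / 5 /\ expR x <= 23 / 5.
Proof.
move=> d3 H.
have z0 : d * d^-1 = 1 by rewrite mulfV // gt_eqF //; lra.
have E : (1 + 3 / d) * (1 + (d - 2) * (3 / d)) <= 9 / 2.
  (* With [z = 1/d] the product is [4 + 6z - 18z^2], maximal at [z = 1/6]. *)
  have -> : (1 + 3 / d) * (1 + (d - 2) * (3 / d)) =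
    (1 + 3 * d^-1) * (1 + 3 * (d * d^-1) - 6 * d^-1) by ring.
  by rewrite z0; have := sqr_ge0 (d^-1 - 6^-1); rewrite expr2; lra.
have H2 : expR x <= 23 / 5 by apply: le_trans H _; lra.
split; last by lra.
rewrite leNgt; apply/negP => h.
have y0 : 0 <= 8 / 5 :> R by lra.
have := expR_ge_sum 5 y0; rewrite !big_ord_recr big_ord0 /= !exprS expr0.
move: h; rewrite -ltr_expR => h; rewrite /factorial /=; lra.
Qed.

Lemma visit_loss_le (R : realType) (w t c : R) : 0 <= w -> w <= c -> 0 <= t ->
  2 * w ^+ 2 * t / (200 * 2 ^+ 7) <= 2 * c ^+ 2 * t / (200 * 2 ^+ 7).
Proof.
move=> w0 wc t0; apply: ler_wpM2r; first by rewrite invr_ge0 mulr_ge0 // exprn_ge0.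
by apply: ler_wpM2r => //; apply: ler_wpM2l => //; rewrite lerXn2r ?nnegrE //; apply: le_trans wc.
Qed.

Lemma admissible_2_4_2 (R : realType) (eps : R) : 23 / 50 <= eps -> admissible eps 2 4 2.
Proof.
move=> He d d2 _; have -> : minn d 2 = 2 by exact/minn_idPr/ltnW.
move=> t x x0; have d3 : 3 <= d%:R :> R by rewrite ler_nat.
case/(exponent_le_t2 d3) => hx he.
have hp : x ^+ 4 <= (23 / 20) ^+ 4 by rewrite lerXn2r ?nnegrE //; apply: le_trans hx.
have hl := visit_loss_le (expR_ge0 x) he (ler0n R 2); rewrite -/t in hl.
have ht : (1 + t)^-1 = 1 / 3 by rewrite /t; field.
have hv : 2 * (63 / 20) ^+ 2 * t / (200 * 2 ^+ 7) <= 1 / 500.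
  by rewrite ler_pdivrMr ?mulr_gt0 ?exprn_gt0 // /t !exprS !expr0; lra.
have hq : x ^+ 4 / 4`!%:R <= 73 / 1000.
  rewrite ler_pdivrMr ?ltr0n //; apply: le_trans hp _.
  by rewrite !exprS expr0 /factorial /=; lra.
have hm : 3 / 100 / 2 ^+ 2 = 3 / 400 :> R by field.
rewrite ht hm; lra.
Qed.

Lemma admissible_2_5_2 (R : realType) (eps : R) : 2 / 5 <= eps -> admissible eps 2 5 2.
Proof.
move=> He d d2 _; have -> : minn d 2 = 2 by exact/minn_idPr/ltnW.
move=> t x x0; have d3 : 3 <= d%:R :> R by rewrite ler_nat.
case/(exponent_le_t2 d3) => hx he.
have hp : x ^+ 5 <= (23 / 20) ^+ 5 by rewrite lerXn2r ?nnegrE //; apply: le_trans hx.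
have hl := visit_loss_le (expR_ge0 x) he (ler0n R 2); rewrite -/t in hl.
have ht : (1 + t)^-1 = 1 / 3 by rewrite /t; field.
have hv : 2 * (63 / 20) ^+ 2 * t / (200 * 2 ^+ 7) <= 1 / 500.
  by rewrite ler_pdivrMr ?mulr_gt0 ?exprn_gt0 // /t !exprS !expr0; lra.
have hq : x ^+ 5 / 5`!%:R <= 17 / 1000.
  rewrite ler_pdivrMr ?ltr0n //; apply: le_trans hp _.
  by rewrite !exprS expr0 /factorial /=; lra.
have hm : 3 / 100 / 2 ^+ 2 = 3 / 400 :> R by field.
rewrite ht hm; lra.
Qed.

Lemma admissible_2_7_3 (R : realType) (eps : R) : 1 / 3 <= eps -> admissible eps 2 7 3.
Proof.
move=> He d d2 _; have -> : minn d 3 = 3 by exact/minn_idPr.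
move=> t x x0; have d3 : 3 <= d%:R :> R by rewrite ler_nat.
case/(exponent_le_t3 d3) => hx he.
have hp : x ^+ 7 / 7`!%:R <= 1 / 100.
  apply: (@le_trans _ _ ((8 / 5) ^+ 7 / 7`!%:R)).
    rewrite ler_wpM2r ?invr_ge0 ?ler0n // lerXn2r ?nnegrE //; apply: le_trans hx => //.
  rewrite !factS fact0 !natrM !exprS expr0; lra.
have hl := visit_loss_le (expR_ge0 x) he (ler0n R 3); rewrite -/t in hl.
have ht : (1 + t)^-1 = 1 / 4 by rewrite /t; field.
have hv : 2 * (23 / 5) ^+ 2 * t / (200 * 2 ^+ 7) <= 1 / 200.
  by rewrite ler_pdivrMr ?mulr_gt0 ?exprn_gt0 // /t !exprS !expr0; lra.
have hm : 3 / 100 / 2 ^+ 2 = 3 / 400 :> R by field.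
move: hp; set y := x ^+ 7 / _ => hp.
rewrite ht hm; lra.
Qed.

Lemma quartic_le_pow16 m : (2 < m)%N -> (45 * m ^ 4 <= 16 ^ m)%N.
Proof.
elim: m => // m IH; rewrite ltnS leq_eqVlt => /orP[/eqP<-//|m3].
have := IH m3; rewrite [(16 ^ m.+1)%N]expnS => h.
apply: leq_trans (_ : 16 * (45 * m ^ 4) <= _)%N; last by rewrite leq_mul2l h orbT.
rewrite mulnCA leq_mul2l /=.
have -> : (16 * m ^ 4 = (2 * m) ^ 4)%N by rewrite expnMn.
by rewrite leq_exp2r //; lia.
Qed.

Lemma admissible_small_eps (R : realType) (eps : R) (m : nat) : 0 < eps -> (2 < m)%N ->
  m%:R * eps <= 1 -> 1 < m.+1%:R * eps -> admissible eps m (4 * m).+1 m.+1.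
Proof.
move=> e0 m2 me me1 d d2 ed t x x0 hx.
have m3 : 3 <= m%:R :> R by rewrite ler_nat.
have m0 : 0 < m%:R :> R by lra.
have mS : m.+1%:R = m%:R + 1 :> R by rewrite natr1.
have md : (m <= d)%N.
  rewrite -(ler_nat R); apply: le_trans ed; rewrite ler_pdivlMr //.
have t0 : 0 <= t by rewrite ler0n.
have tm : t <= m%:R + 1 by rewrite -mS ler_nat geq_minr.
have td : t <= d%:R by rewrite ler_nat geq_minl.
have d0 : 0 < d%:R :> R by rewrite ltr0n; exact: leq_trans d2.
have dd2 : 2 <= d%:R :> R by rewrite ler_nat ltnW.
(* For [s = t/d <= 1] the product in [hx] is at most [1 + 2t], whatever the degree. *)
have W : expR x <= 3 * m%:R + 1.
  apply: le_trans hx _.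
  have s1 : t / d%:R <= 1 by rewrite ler_pdivrMr // mul1r.
  have s0 : 0 <= t / d%:R by rewrite divr_ge0 // ltW.
  have ds : d%:R * (t / d%:R) = t by rewrite mulrCA mulfV ?mulr1 // gt_eqF.
  have : (1 + t / d%:R) * (1 + (d%:R - 2) * (t / d%:R)) <= 1 + 2 * t.
    move: s0 s1 ds; set s := t / d%:R => s0 s1 ds.
    have -> : (1 + s) * (1 + (d%:R - 2) * s) = (1 + s) * (1 + d%:R * s - 2 * s) by ring.
    rewrite ds; have := mulr_ge0 t0 (_ : 0 <= 1 - s); rewrite subr_ge0 => /(_ s1).
    have := mulr_ge0 s0 s0; lra.
  move=> h; apply: le_trans (_ : 201 / 200 * (1 + 2 * t) <= _); last by lra.
  by apply: ler_wpM2l; [clear; lra | exact: h].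
have W2 : expR x ^+ 2 <= 12 * m%:R ^+ 2.
  apply: (@le_trans _ _ ((3 * m%:R + 1) ^+ 2)); last by rewrite !expr2; nra.
  by rewrite lerXn2r ?nnegrE ?expR_ge0 //; lra.
have m20 : 0 < m%:R ^+ 2 :> R by rewrite exprn_gt0.
set iv : R := (m%:R ^+ 2)^-1.
have iv0 : 0 < iv by rewrite invr_gt0.
have A : x ^+ (4 * m).+1 / (4 * m).+1`!%:R <= 2 / 15 * iv.
  apply: le_trans (expr_fact_le_expR (4 * m).+1 x0) _.
  have P0 : 0 < 2 ^+ (4 * m).+1 :> R by rewrite exprn_gt0.
  have E : 2 ^+ (4 * m).+1 = 2 * (16 ^ m)%:R :> R.
    by rewrite exprS exprM natrX; congr (_ * _ ^+ _); rewrite -natrX.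
  have Q : 45 * m%:R ^+ 4 <= (16 ^ m)%:R :> R.
    by rewrite -natrX -natrM ler_nat quartic_le_pow16.
  rewrite ler_pdivrMr // E; apply: le_trans W2 _.
  have -> : 12 * m%:R ^+ 2 = 2 / 15 * iv * (2 * (45 * m%:R ^+ 4)).
    by rewrite /iv; field; rewrite gt_eqF.
  apply: ler_wpM2l; last by rewrite ler_wpM2l.
  by move: iv0; clear; lra.
have B : 2 * expR x ^+ 2 * t / (200 * m%:R ^+ 7) <= 1 / 50 * iv.
  have P0 : 0 < 200 * m%:R ^+ 7 :> R by rewrite mulr_gt0 ?exprn_gt0.
  rewrite ler_pdivrMr //.
  have -> : 1 / 50 * iv * (200 * m%:R ^+ 7) = 4 * m%:R ^+ 5.
    by rewrite /iv; field; rewrite gt_eqF.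
  apply: (@le_trans _ _ (2 * (12 * m%:R ^+ 2) * (4 / 3 * m%:R))).
    apply: ler_pM => //; rewrite ?mulr_ge0 ?exprn_ge0 ?expR_ge0 //; last by lra.
    by rewrite ler_wpM2l.
  have -> : 2 * (12 * m%:R ^+ 2) * (4 / 3 * m%:R) = 32 * m%:R ^+ 3 :> R by field.
  have -> : 4 * m%:R ^+ 5 = 4 * m%:R ^+ 2 * m%:R ^+ 3 :> R by ring.
  by rewrite ler_wpM2r ?exprn_ge0 ?(ltW m0) // expr2; nra.
(* The three other losses add up to [3/2 * 2/15 + 3/100 + 1/50 = 1/4] in units of [iv]. If [d = m],
   time already ends at [t = m], but then [eps >= 1/d = 1/m]. *)
have C : (1 + t)^-1 + 1 / 4 * iv <= eps.
  have me' : (m%:R + 1) * eps > 1 by rewrite -mS.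
  have [dm|dm] := leqP m.+1 d.
    have -> : t = m%:R + 1 by rewrite /t (minn_idPr dm) mS.
    have h1 : (m%:R + 1)^-1 <= eps by rewrite -[leLHS]mul1r ler_pdivrMr; lra.
    apply: le_trans h1.
    rewrite -subr_ge0.
    have -> : (m%:R + 1)^-1 - ((1 + (m%:R + 1))^-1 + 1 / 4 * iv) =
       (3 * m%:R ^+ 2 - 3 * m%:R - 2) / (4 * (m%:R + 1) * (m%:R + 2) * m%:R ^+ 2).
      by rewrite /iv; field; rewrite !gt_eqF //; lra.
    have M1 : 0 <= m%:R + 1 :> R by move: m0; clear; lra.
    have M2 : 0 <= m%:R + 2 :> R by move: m0; clear; lra.
    apply: divr_ge0; last by rewrite !mulr_ge0 ?exprn_ge0 ?(ltW m0).
    by move: m3; clear; rewrite expr2; nra.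
  have dE : d = m by apply/eqP; rewrite eqn_leq md andbT -ltnS.
  have -> : t = m%:R by rewrite /t (minn_idPl (ltnW dm)) dE.
  have h1 : (m%:R)^-1 <= eps
    by rewrite -[leLHS]mul1r ler_pdivrMr //; move: ed; rewrite dE ler_pdivrMr // mulrC.
  apply: le_trans h1.
  rewrite -subr_ge0.
  have -> : (m%:R)^-1 - ((1 + m%:R)^-1 + 1 / 4 * iv) =
       (3 * m%:R - 1) / (4 * (m%:R + 1) * m%:R ^+ 2).
    by rewrite /iv; field; rewrite !gt_eqF //; lra.
  have M1 : 0 <= m%:R + 1 :> R by move: m0; clear; lra.
  apply: divr_ge0; last by rewrite !mulr_ge0 ?exprn_ge0 ?(ltW m0).
  by move: m3; clear; lra.
rewrite -/iv.
move: A B C; set a := x ^+ _ / _; set c := 2 * _ * t / _; lra.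
Qed.

(** At depth 1 an edge is accepted when its rank is below those of its [2b] adjacent edges. The sum
    is a right Riemann sum of [(1-s)^(2b)], whose integral is [1/(2b+1)], and it falls short by at
    most [p]. *)
Lemma localmin_density (R : realType) (b N : nat) : (0 < N)%N ->
  1 - b.*2.+1%:R * (N%:R^-1 : R) <=
  b.*2.+1%:R * ((N%:R^-1 : R) * \sum_(i < N) pfree R N b 1 i ^+ 2).
Proof.
move=> N0; set p : R := N%:R^-1; have p0 : 0 <= p by exact: p_ge0.
have fE i : pfree R N b 1 i = (1 - p * i.+1%:R) ^+ b.
  rewrite pfreeS /surv; congr (_ ^+ _); congr (_ - _ * _).
  by rewrite (eq_bigr (fun=> 1)) ?sumr_const ?card_ord // => j _; rewrite subr0.
under eq_bigr do rewrite fE -exprM muln2.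
(* The terms added to the sum turn it into the left Riemann sum, which dominates the integral step
   by step. *)
have H T : (T <= N)%N -> 1 - (1 - p * T%:R) ^+ b.*2.+1 <=
    b.*2.+1%:R * (p * (\sum_(i < T) (1 - p * i.+1%:R) ^+ b.*2 + 1 - (1 - p * T%:R) ^+ b.*2)).
  elim: T => [|T IH] TN; first by rewrite big_ord0 mulr0 !subr0 !expr1n; lra.
  have z0 : 0 <= 1 - p * T.+1%:R by rewrite subr_ge0 mulrC mulp_le1.
  have z1 : 1 - p * T.+1%:R <= 1 - p * T%:R by rewrite lerD2l lerN2 ler_wpM2l // ler_nat.
  have := subrX_le b.*2.+1 z0 z1; have := IH (ltnW TN); rewrite big_ord_recr /=.
  have -> : 1 - p * T%:R - (1 - p * T.+1%:R) = p by rewrite -natr1; ring.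
  set a := (1 - p * T%:R) ^+ b.*2.+1; set c := (1 - p * T.+1%:R) ^+ b.*2.+1.
  set a' := (1 - p * T%:R) ^+ b.*2; set c' := (1 - p * T.+1%:R) ^+ b.*2.
  set S := \sum_(i < T) _; set B : R := b.*2.+1%:R => h1 h2.
  have -> : B * (p * (S + c' + 1 - c')) = B * (p * (S + 1 - a')) + B * a' * p by ring.
  lra.
have := H N (leqnn N).
have -> : 1 - p * N%:R = 0 by rewrite mulVf ?subrr // pnatr_eq0 -lt0n.
rewrite exprS mul0r subr0; set S := \sum_(i < N) _ => h.
have h2 : b.*2.+1%:R * (p * (S + 1 - 0 ^+ b.*2)) <= b.*2.+1%:R * (p * S) + b.*2.+1%:R * p.
  rewrite -mulrDr ler_wpM2l ?ler0n //.
  have -> : p * S + p = p * (S + 1) by ring.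
  by rewrite ler_wpM2l // gerBl exprn_ge0.
lra.
Qed.

Lemma localmin_lca_correct (R : realType) (eps : R) : 2^-1 <= eps -> eps < 1 ->
  exists A : lca R,
  forall (n : nat) (G : graph n) (d : nat),
    regular G d ->
    1 / eps <= d%:R ->
    ((1 / eps ^+ 3)%:E <= girth R G)%E ->
    [/\ forall r : seed A n, is_matching G (lca_edges G r),
        (1 - eps) * (max_matching_size G)%:R <= lca_expected_size A G
      & forall (r : seed A n) (e : {set 'I_n}), e \in edges G ->
          (num_probes G (strategy r e))%:R <= 200 / eps ^+ 7].
Proof.
move=> e2 e1; have e0 : 0 < eps by lra.
(* Quadratic in [n], so that ties cost at most [d (2d-1) / N <= 1/2], the excess of [d] over
   [(2d-1)/2]. *)
pose Nf n := (4 * n.+1 ^ 2)%N.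
have Nf0 n : (0 < Nf n)%N by rewrite muln_gt0 expn_gt0.
exists (greedy_lca R 1 (fun n _ => Nf n) 3 Nf0) => n G d reg ed _; split.
- by move=> r; apply: greedy_lca_matching reg.
- case: (posnP n) => [n0|n0].
    by subst n; rewrite max_matching0 mulr0 lca_expected_ge0.
  have dn : (d <= n)%N by apply: ltnW; apply: regular_lt reg n0.
  have d0 : (0 < d)%N.
    by rewrite -(ltr_nat R); apply: lt_le_trans ed; rewrite divr_gt0.
  case: d d0 reg ed dn => // b _ reg ed dn.
  (* Depth 1 only asks for cycles longer than 2, which is part of [is_cycle]. *)
  have gG : big_girth G 1 by move=> c [].
  set N := Nf n; set p : R := N%:R^-1.
  have p0 : 0 < p by rewrite invr_gt0 ltr0n; exact: Nf0.
  pose q := p * \sum_(i < N) pfree R N b 1 i ^+ 2.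
  apply: (@greedy_lca_size R Nf 1 (fun n _ => Nf n) 3 Nf0 n G b.+1 (1 - eps) q) => //.
  + by lra.
  + have h := @localmin_density R b N (Nf0 n); rewrite -/p -/q in h.
    have bE : b.*2.+1%:R = 2 * b%:R + 1 :> R by rewrite -natr1 -muln2 natrM mulrC.
    have dE : b.+1%:R = b%:R + 1 :> R by rewrite natr1.
    have b0 : 0 <= b%:R :> R by rewrite ler0n.
    have Np : 4 * b.+1%:R ^+ 2 * p <= 1.
      rewrite ler_pdivrMr ?ltr0n ?Nf0 // mul1r -natrX -natrM ler_nat leq_mul2l /=.
      by rewrite leq_exp2r // ltnW.
    apply: (@le_trans _ _ 2^-1); first by lra.
    rewrite bE in h; rewrite dE in Np *.
    have B0 : 0 < 2 * b%:R + 1 :> R by lra.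
    rewrite -(ler_pM2l B0).
    have -> : (2 * b%:R + 1) * ((b%:R + 1) * q) = (b%:R + 1) * ((2 * b%:R + 1) * q) by ring.
    have B1 : 0 <= b%:R + 1 :> R by lra.
    apply: le_trans (ler_wpM2l B1 h).
    have : (b%:R + 1) * ((2 * b%:R + 1) * p) <= 2^-1.
      apply: (@le_trans _ _ (2 * (b%:R + 1) ^+ 2 * p)); last by lra.
      rewrite mulrA ler_wpM2r ?(ltW p0) // expr2.
      have := mulr_ge0 b0 b0; lra.
    lra.
  + move=> e eE; have [u [v [uv Ee En]]] := edgeP eE.
    have := @Ex_accept R n N b 1 N G (Nf0 n) reg isT gG (leqnn N) u v uv.
    rewrite -/p -/q => <-; apply: ler_Ex => w; rewrite answer_trunc.
    have [-> np] := query_spec w 1 (fun=> Nf n) reg Ee En.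
    (* One probe for the degree and one at each end, so nothing is truncated. *)
    suff -> : (num_probes G (query w 1 (fun=> Nf n) e) <= 3)%N by rewrite andbT.
    apply: leq_trans np _; by rewrite /= !big1 // ltnS; case: (_ < _)%N.
- move=> r e _; apply: (@le_trans _ _ 3).
    by rewrite ler_nat; exact: greedy_lca_probes.
  rewrite ler_pdivlMr ?exprn_gt0 //.
  have : eps ^+ 7 <= 1 by rewrite exprn_ile1 // ltW.
  lra.
Qed.

Theorem theorem8 (R : realType) :
  exists C : R, 0 < C /\
  forall eps : R, 0 < eps ->
  exists A : lca R,
  forall (n : nat) (G : graph n) (d : nat),
    regular G d ->
    1 / eps <= d%:R ->
    ((1 / eps ^+ 3)%:E <= girth R G)%E ->
    [/\ forall r : seed A n, is_matching G (lca_edges G r),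
        (1 - eps) * (max_matching_size G)%:R <= lca_expected_size A G
      & forall (r : seed A n) (e : {set 'I_n}), e \in edges G ->
          (num_probes G (strategy r e))%:R <= C / eps ^+ 7].
Proof.
exists 200; split => // eps e0.
(* Here [1 - eps <= 0], so any valid matching is large enough and no probe is made. *)
have [e1|e1] := leP 1 eps.
  exists (greedy_lca R 0 (fun _ _ => 0%N) 0 (fun=> ltn0Sn 0)) => n G d reg _ _; split.
  - by move=> r; apply: greedy_lca_matching reg.
  - apply: le_trans (lca_expected_ge0 _ _); rewrite mulr_le0_ge0 ?ler0n //; lra.
  - move=> r e _; have := greedy_lca_probes G r e; rewrite leqn0 => /eqP ->.
    by rewrite divr_ge0 // exprn_ge0 // ltW.
have [e2|e2] := leP 2^-1 eps; first exact: localmin_lca_correct.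
have e30 : 0 < eps ^+ 3 by rewrite exprn_gt0.
have [e3|e3] := leP (1 / 3) eps; last first.
  pose m := Num.truncn (1 / eps).
  have e0' : 0 <= 1 / eps by rewrite divr_ge0 // ltW.
  have /andP[me me1] := truncn_itv e0'; rewrite -/m in me me1.
  rewrite ler_pdivlMr // in me; rewrite ltr_pdivrMr // in me1.
  have m2 : (2 < m)%N.
    rewrite -ltnS -(ltr_nat R) -(ltr_pM2r e0); apply: lt_trans me1.
    by lra.
  apply: (@greedy_lca_correct R eps m (4 * m).+1 m.+1) => //; first exact: ltnW.
  (* The girth must exceed [8m + 2], and [8m + 2 < m^3] from [m = 3] on, where it reads [26 < 27].
     It fails for [m = 2], hence the separate treatment of [eps >= 1/3]. *)
  - rewrite ltr_pdivlMr //.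
    have : (m%:R * eps) ^+ 3 <= 1 by rewrite exprn_ile1 // mulr_ge0 ?ler0n // ltW.
    rewrite exprMn; apply: lt_le_trans; rewrite ltr_pM2r // -natrX ltr_nat.
    by rewrite !expnS expn0 -muln2; nia.
  - exact: admissible_small_eps.
(* For [eps] between [1/3] and [1/2] the girth is scarce: near [1/2] it only exceeds 8, which forces
   depth 4. Each breakpoint is a value below which a greater depth (5, then 7) fits under
   [1 / eps^3], and above which the previous depth meets its error budget. *)
have e2' : 2 * eps <= 1 by lra.
have cube c : eps < c -> eps ^+ 3 < c ^+ 3.
  by move=> ec; rewrite ltrXn2r ?nnegrE // ltW.
have [e4|e4] := leP (23 / 50) eps.
  apply: (@greedy_lca_correct R eps 2 4 2) => //; last exact: admissible_2_4_2.
rewrite ltr_pdivlMr // -[4.*2]/8%N; have h : eps ^+ 3 < 8^-1.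
    by apply: lt_le_trans (cube _ e2) _; rewrite !exprS expr0; lra.
  by move: h; set y := eps ^+ 3; lra.
have [e5|e5] := leP (2 / 5) eps.
  apply: (@greedy_lca_correct R eps 2 5 2) => //; last exact: admissible_2_5_2.
rewrite ltr_pdivlMr // -[5.*2]/10%N; have h : eps ^+ 3 < 10^-1.
    by apply: lt_le_trans (cube _ e4) _; rewrite !exprS expr0; lra.
  by move: h; set y := eps ^+ 3; lra.
apply: (@greedy_lca_correct R eps 2 7 3) => //; last exact: admissible_2_7_3.
rewrite ltr_pdivlMr // -[7.*2]/14%N; have h : eps ^+ 3 < 14^-1.
    by apply: lt_le_trans (cube _ e5) _; rewrite !exprS expr0; lra.
  by move: h; set y := eps ^+ 3; lra.
Qed.
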